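(* Let $\{S(t): t\ge 0\}$ be a semigroup on a nonempty closed subset $V$ of a Hilbert space $(X,\|\cdot\|_X)$ over $\mathbb{K}\in\{\mathbb{R},\mathbb{C}\}$ and $\mathbf{B}\subseteq V$ be a bounded absorbing set for the semigroup. Moreover, let $\{S(t): t\ge 0\}$ be asymptotically closed or $\mathbf{B}$ be closed. If the semigroup is of Ladyzhenskaya type on $\mathbf{B}$ at time $T>0$ with parameters $(n,\eta,\kappa)$ with an orthogonal projection $P$ onto an $n$-dimensional subspace $X_n$ of $X$, then for any $\sigma\in(0,\sqrt{1-\eta^2})$ there exists a $T$-discrete exponential attractor $\mathbf{M_0}\subseteq\mathbf{B}$ for the semigroup and $$\dim_f^{V}(\mathbf{M_0})\le\mathbf{n}\log_{\frac{1}{\sqrt{\sigma^2+\eta^2}}}\left(1+\tfrac{2\kappa}{\sigma}\right),$$ where $\mathbf{n}=n$ if $\mathbb{K}=\mathbb{R}$ and $\mathbf{n}=2n$ if $\mathbb{K}=\mathbb{C}$. If the semigroup is asymptotically closed, then it has a global attractor $\mathbf{A}$ contained in $\mathbf{M_0}$.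
   Context: $V$ carries the metric $d(x,y)=\|x-y\|_X$. A semigroup $\{S(t):t\ge0\}$ on $V$ is a family of (not necessarily linear) maps $S(t):V\to V$ with $S(t)S(s)=S(t+s)$ for $t,s\ge 0$ and $S(0)=I$; ''$t\ge 0$'' means throughout either $t\in[0,\infty)$ or $t\in\mathbb{N}_0=\{0,1,2,\dots\}$ (and $T$ belongs to the time set). Ladyzhenskaya type on $B\subseteq V$ at time $T>0$ with parameters $(n,\eta,\kappa)$ with the map $P$ into the $n$-dimensional subspace $X_n$ ($n\in\{1,2,\dots\}$): $\eta\in[0,1)$, $\kappa>0$ and for all $x,y\in B$ $$\|(I-P)S(T)x-(I-P)S(T)y\|_X\le\eta\|x-y\|_X,\qquad\|PS(T)x-PS(T)y\|_X\le\kappa\|x-y\|_X.$$ Asymptotically closed: for any $t\ge 0$, $t_k\ge 0$ with $t_k\to\infty$ and any bounded sequence $x_k\in V$, if $S(t_k)x_k\to x$ and $S(t+t_k)x_k\to y$ with $x,y\in V$, then $S(t)x=y$. Absorbing set: $\mathbf{B}\subseteq V$ such that for every bounded $G\subseteq V$ there is $t_G\ge 0$ with $S(t)G\subseteq\mathbf{B}$ for all $t\ge t_G$. $\mathrm{dist}^V(G,H)=\sup_{x\in G}\inf_{y\in H}d(x,y)$. $N^V(G,\varepsilon)$ is the minimal number of open $\varepsilon$-balls in $V$ centered at points of $G$ needed to cover $G$; $\dim_f^V(G)=\limsup_{\varepsilon\to0^+}\log_{1/\varepsilon}N^V(G,\varepsilon)$. Global attractor: a nonempty compact set $\mathbf{A}\subseteq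 V$ with $S(t)\mathbf{A}=\mathbf{A}$ for all $t\ge 0$ and $\lim_{t\to\infty}\mathrm{dist}^V(S(t)G,\mathbf{A})=0$ for every bounded $G\subseteq V$. $T$-discrete exponential attractor: a nonempty compact set $\mathbf{M_0}\subseteq V$ such that $S(T)\mathbf{M_0}\subseteq\mathbf{M_0}$, $\dim_f^V(\mathbf{M_0})<\infty$, and there is $\xi>0$ with $\lim_{t\to\infty}e^{\xi t}\mathrm{dist}^V(S(t)G,\mathbf{M_0})=0$ for every bounded $G\subseteq V$. *)

(* Defs.v *)
From HB Require Import structures.
From mathcomp Require Import all_boot all_order all_algebra.
From mathcomp Require Import all_classical all_reals all_analysis.
From mathcomp Require Import complex.

Set Implicit Arguments.
Unset Strict Implicit.
Unset Printing Implicit Defensive.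

Import Order.TTheory GRing.Theory Num.Theory.
Import numFieldNormedType.Exports.

Local Open Scope classical_set_scope.
Local Open Scope ring_scope.

Inductive scalar_kind := RealScalars | ComplexScalars.

Definition scalars (R : realType) (k : scalar_kind) : numFieldType :=
  match k with
  | RealScalars => R
  | ComplexScalars => R[i]
  end.

Definition scalar_conj (R : realType) (k : scalar_kind) :
    scalars R k -> scalars R k :=
  match k with
  | RealScalars => @idfun R
  | ComplexScalars => @Num.conj R[i]
  end.

Definition scalar_Re (R : realType) (k : scalar_kind) : scalars R k -> R :=
  match k with
  | RealScalars => @idfun R
  | ComplexScalars => @complex.Re R
  end.

(* The dimension over the reals of an n-dimensional space over K. *)
Definition real_dim (k : scalar_kind) (n : nat) : nat :=
  match k with
  | RealScalars => n
  | ComplexScalars => (2 * n)%N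
  end.

Section HilbertSpace.
Context {R : realType} {k : scalar_kind}.
Local Notation K := (scalars R k).

(* The norm of a normed module over K takes its values in K; rnorm is the same
   norm as a real number. *)
Definition rnorm (X : normedModType K) (x : X) : R := scalar_Re `|x|.

(* A complete normed module is a Hilbert space when its norm comes from the
   inner product ip (linear in the first argument). *)
Definition norm_of_inner_product (X : normedModType K)
    (ip : {dot X for @scalar_conj R k}) : Prop :=
  forall x : X, `|x| ^+ 2 = ip x x.

Definition is_subspace_of_dim (X : lmodType K) (n : nat) (Xn : set X) : Prop :=
  exists e : 'I_n -> X,
    (forall c : 'I_n -> K, \sum_(i < n) c i *: e i = 0 -> forall i, c i = 0) /\
    Xn = range (fun c : 'I_n -> K => \sum_(i < n) c i *: e i).

Definition is_orthogonal_projection (X : lmodType K)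
    (ip : {dot X for @scalar_conj R k}) (P : X -> X) (Xn : set X) : Prop :=
  forall x : X, Xn (P x) /\ forall y : X, Xn y -> ip (x - P x) y = 0.

End HilbertSpace.

Section MetricNotions.
Context {R : realType} {k : scalar_kind} {X : normedModType (scalars R k)}.

(* The supremum is taken in [0, +oo], so that hsdist set0 H = 0. *)
Definition hsdist (G H : set X) : \bar R :=
  maxe 0%E (ereal_sup [set ereal_inf [set (rnorm (x - y))%:E | y in H]
                    | x in G]).

Definition is_ball_cover (G : set X) (eps : R) (m : nat) : Prop :=
  exists c : 'I_m -> X,
    (forall i, G (c i)) /\
    G `<=` \bigcup_(i in [set: 'I_m]) [set x | rnorm (x - c i) < eps].

(* Equal to +oo when there is no finite cover. *)
Definition covering_number (G : set X) (eps : R) : \bar R :=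
  ereal_inf [set (m%:R)%:E | m in [set m : nat | is_ball_cover G eps m]].

Definition fractal_dim (G : set X) : \bar R :=
  limf_esup (fun eps : R =>
    (lne (covering_number G eps) * ((ln (1 / eps))^-1)%:E)%E) 0^'+.

End MetricNotions.

Definition log_base {R : realType} (b x : R) : R := ln x / ln b.

Definition is_time_set {R : realType} (Ts : set R) : Prop :=
  Ts = [set t | 0 <= t] \/ Ts = range (fun m : nat => m%:R).

(* S t is a map of V into itself, represented by a function on X whose values
   outside V, and at times outside Ts, are irrelevant. *)
Section Semigroup.
Context {R : realType} {k : scalar_kind} {X : normedModType (scalars R k)}.
Context (Ts : set R) (V : set X) (S : R -> X -> X).

Definition is_semigroup : Prop :=
  [/\ forall t, Ts t -> S t @` V `<=` V,
      forall t s x, Ts t -> Ts s -> V x -> S t (S s x) = S (t + s) x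
    & forall x, V x -> S 0 x = x].

Definition ladyzhenskaya_type (B : set X) (T : R) (n : nat) (eta kappa : R)
    (P : X -> X) (Xn : set X) : Prop :=
  [/\ Ts T /\ 0 < T,
      (0 < n)%N /\ is_subspace_of_dim n Xn,
      0 <= eta < 1 /\ 0 < kappa,
      range P `<=` Xn
    & forall x y, B x -> B y ->
        rnorm ((S T x - P (S T x)) - (S T y - P (S T y)))
          <= eta * rnorm (x - y) /\
        rnorm (P (S T x) - P (S T y)) <= kappa * rnorm (x - y)].

Definition asymptotically_closed : Prop :=
  forall (t : R) (t_ : nat -> R) (x_ : nat -> X) (x y : X),
    Ts t -> (forall j, Ts (t_ j)) -> t_ @ \oo --> +oo ->
    (forall j, V (x_ j)) -> bounded_set (range x_) ->
    V x -> V y ->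
    (fun j => S (t_ j) (x_ j)) @ \oo --> x ->
    (fun j => S (t + t_ j) (x_ j)) @ \oo --> y ->
    S t x = y.

Definition absorbing_set (B : set X) : Prop :=
  B `<=` V /\
  forall G : set X, G `<=` V -> bounded_set G ->
    exists2 tG, Ts tG & forall t, Ts t -> tG <= t -> S t @` G `<=` B.

Definition global_attractor (A : set X) : Prop :=
  [/\ A `<=` V, A !=set0, compact A,
      forall t, Ts t -> S t @` A = A
    & forall G : set X, G `<=` V -> bounded_set G ->
        hsdist (S t @` G) A @[t --> within Ts (pinfty_nbhs R)] --> 0%E].

Definition discrete_exponential_attractor (T : R) (M : set X) : Prop :=
  [/\ M `<=` V /\ M !=set0, compact M,
      S T @` M `<=` M,
      (fractal_dim M < +oo)%E
    & exists2 xi : R, 0 < xi &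
        forall G : set X, G `<=` V -> bounded_set G ->
          ((expR (xi * t))%:E * hsdist (S t @` G) M)%E
            @[t --> within Ts (pinfty_nbhs R)] --> 0%E].

End Semigroup.

(* Main.v *)
(* Put [f = S T], [theta = sqrt (sigma^2 + eta^2)] and [h = (1 + 2 kappa / sigma)^d],
   where [d] is the real dimension of [Xn]. The core is a covering estimate: for an
   [f]-invariant [D] included in [B], of diameter at most [r], [iter m f @` D] is
   covered by [h^m] balls of radius [theta^m r] centered in it. Its proof bounds a
   separated set by repeatedly thinning out a finite subset of [D]. If the images
   under [iter j f] have mutual distances at most [rho], then the projections of
   their images under [f] lie in a ball of radius [kappa rho]; by averaging, some
   ball of radius [sigma rho / 2] in [Xn] contains a proportion [1 / h] of them, and
   the points retained are mapped by [iter j.+1 f] to points at mutual distances at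
   most [theta rho], by Pythagoras. Measuring mutual distances rather than distances
   to a center gives [theta] and [h] without losing a factor 2, and without an
   isodiametric inequality.

   [M0] is the closure of the orbits of the centers. When [B] is not closed, the
   points of [M0] that are not on these orbits are in the omega-limit set of [B],
   which is invariant by asymptotic closedness, hence included in [B]. *)

Require Import Defs.
From HB Require Import structures.
From mathcomp Require Import all_boot all_order all_algebra.
From mathcomp Require Import all_classical all_reals all_analysis.
From mathcomp Require Import complex.
From mathcomp Require Import ring lra zify.

Set Implicit Arguments.
Unset Strict Implicit.
Unset Printing Implicit Defensive.

Import Order.TTheory GRing.Theory Num.Theory.
Import numFieldNormedType.Exports.

Local Open Scope classical_set_scope.
Local Open Scope ring_scope.

(** * Scalars and norms *)

Section Scalars.
Context {R : realType} {k : scalar_kind}.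
Local Notation K := (scalars R k).

(** The embedding of [R] in [K], a right inverse of [scalar_Re]. Inequalities between real norms are
    proved by moving them to [K], where the library norm takes its values. *)
Definition of_real : R -> K :=
  match k return R -> scalars R k with
  | RealScalars => id
  | ComplexScalars => fun x => real_complex R x
  end.

Lemma of_realD : {morph of_real : x y / x + y}.
Proof. by rewrite /of_real; case: k => x y //=; rewrite rmorphD. Qed.

Lemma of_realM : {morph of_real : x y / x * y}.
Proof. by rewrite /of_real; case: k => x y //=; rewrite rmorphM. Qed.

Lemma of_real0 : of_real 0 = 0.
Proof. by rewrite /of_real; case: k. Qed.

Lemma of_real1 : of_real 1 = 1.
Proof. by rewrite /of_real; case: k. Qed.

Lemma ler_of_real x y : (of_real x <= of_real y) = (x <= y).
Proof. by rewrite /of_real; case: k => //=; rewrite lecR. Qed.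

Lemma ltr_of_real x y : (of_real x < of_real y) = (x < y).
Proof. by rewrite /of_real; case: k => //=; rewrite ltcR. Qed.

Lemma of_real_ge0 x : (0 <= of_real x) = (0 <= x).
Proof. by rewrite -of_real0 ler_of_real. Qed.

Lemma of_realK : cancel of_real (@scalar_Re R k).
Proof. by rewrite /of_real /scalar_Re; case: k. Qed.

Lemma of_real_Re (a : K) : a \is Num.real -> of_real (scalar_Re a) = a.
Proof.
rewrite /of_real /scalar_Re; move: a; case: k => //= a.
by move=> /RRe_real.
Qed.

Lemma scalar_Re_norm_ge0 (a : K) : 0 <= scalar_Re `|a|.
Proof. by rewrite -of_real_ge0 of_real_Re ?normr_ge0 ?normr_real. Qed.

Lemma scalar_Re_normM (a b : K) :
  scalar_Re `|a * b| = scalar_Re `|a| * scalar_Re `|b|.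
Proof.
apply: (can_inj of_realK).
by rewrite of_realM !of_real_Re ?normr_real// normrM.
Qed.

Lemma scalar_Re_norm_of_real x : 0 <= x -> scalar_Re `|of_real x| = x.
Proof. by move=> x0; rewrite ger0_norm ?of_realK// of_real_ge0. Qed.

Lemma scalar_conjD : {morph @scalar_conj R k : x y / x + y}.
Proof. by rewrite /scalar_conj; case: k => x y //=; rewrite rmorphD. Qed.

Lemma scalar_conjM : {morph @scalar_conj R k : x y / x * y}.
Proof. by rewrite /scalar_conj; case: k => x y //=; rewrite rmorphM. Qed.

Lemma scalar_conj0 : @scalar_conj R k 0 = 0.
Proof. by rewrite /scalar_conj; case: k => //=; rewrite rmorph0. Qed.

Lemma scalar_conj_of_real x : scalar_conj (of_real x) = of_real x.
Proof.
rewrite /scalar_conj /of_real; case: k => //=.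
by rewrite (CrealP _)// complex_real.
Qed.

End Scalars.

Section Rnorm.
Context {R : realType} {k : scalar_kind} {X : normedModType (scalars R k)}.
Local Notation K := (scalars R k).
Implicit Types x y z : X.

Lemma of_real_rnorm x : of_real (rnorm x) = `|x|.
Proof. by rewrite /rnorm of_real_Re// normr_real. Qed.

Lemma rnorm_ge0 x : 0 <= rnorm x.
Proof. by rewrite -(@of_real_ge0 _ k) of_real_rnorm. Qed.

Lemma rnorm0 : rnorm (0 : X) = 0.
Proof. by rewrite /rnorm normr0 /scalar_Re; case: k. Qed.

Lemma rnorm_eq0 x : rnorm x = 0 -> x = 0.
Proof.
move=> x0; apply/eqP; rewrite -normr_eq0 -of_real_rnorm x0.
by rewrite of_real0.
Qed.

Lemma rnormN x : rnorm (- x) = rnorm x.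
Proof. by rewrite /rnorm normrN. Qed.

Lemma rnormB x y : rnorm (x - y) = rnorm (y - x).
Proof. by rewrite -rnormN opprB. Qed.

Lemma rnormD x y : rnorm (x + y) <= rnorm x + rnorm y.
Proof. by rewrite -(@ler_of_real _ k) of_realD !of_real_rnorm ler_normD. Qed.

Lemma rnorm_triangle z x y : rnorm (x - y) <= rnorm (x - z) + rnorm (z - y).
Proof. by apply: le_trans (rnormD _ _); rewrite addrA subrK. Qed.

Lemma rnormZ (a : K) x : rnorm (a *: x) = scalar_Re `|a| * rnorm x.
Proof.
apply: (can_inj (@of_realK R k)).
by rewrite of_realM !of_real_rnorm of_real_Re ?normr_real// normrZ.
Qed.

(** Library balls have radii in [K]; a positive element of [K] is real, even when [K] is complex, so
    [scalar_Re] and [of_real] exchange the radii. *)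
Lemma nbhs_rnormP x (U : set X) :
  nbhs x U <-> exists2 e : R, 0 < e & forall y, rnorm (x - y) < e -> U y.
Proof.
split=> [/nbhs_ballP[e /= e_gt0 eU]|[e e_gt0 eU]].
  have eR : of_real (scalar_Re e) = e by rewrite of_real_Re// gtr0_real.
  exists (scalar_Re e); first by rewrite -(@ltr_of_real _ k) eR of_real0.
  move=> y xy; apply: eU; rewrite -ball_normE /ball_/=.
  by rewrite -of_real_rnorm -eR ltr_of_real.
apply/nbhs_ballP; exists (of_real e) => /=; first by rewrite -of_real0 ltr_of_real.
move=> y; rewrite -ball_normE /ball_/= -of_real_rnorm ltr_of_real; exact: eU.
Qed.

Lemma bounded_set_rnormP (G : set X) :
  bounded_set G <-> exists C : R, forall x, G x -> rnorm x <= C.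
Proof.
split=> [[M [Mr GM]]|[C GC]].
  exists (scalar_Re (M + 1)) => x Gx.
  rewrite -(@ler_of_real _ k) of_real_rnorm of_real_Re ?realD ?real1//.
  by apply: GM Gx; rewrite ltrDl.
exists (of_real C); split.
  by rewrite /of_real; case: k => //=; rewrite ?num_real ?complex_real.
move=> M CM x Gx; have := GC x Gx.
rewrite -(@ler_of_real _ k) of_real_rnorm => xC.
exact: le_trans xC (ltW CM).
Qed.

End Rnorm.

(** * Balls containing many points of a finite set *)

Lemma bernoulli_ler (R : realDomainType) (x : R) (i : nat) :
  0 <= x -> 1 + x *+ i <= (1 + x) ^+ i.
Proof.
move=> x0; elim: i => [|i IH]; first by rewrite mulr0n addr0 expr0.
rewrite exprS; apply: (@le_trans _ _ ((1 + x) * (1 + x *+ i))).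
  rewrite mulrDl mul1r mulrDr mulr1 mulrS.
  have : 0 <= x * (x *+ i) by rewrite mulr_ge0// mulrn_wge0.
  lra.
by rewrite ler_wpM2l// addr_ge0.
Qed.

(** If [b < a] with [b] nonzero, then [(a / b) ^+ i] is unbounded by Bernoulli. This power trick is
    what erases the constant of a crude covering bound. *)
Lemma ler_of_expr_le_mul (R : archiRealFieldType) (a b C : R) :
  0 <= a -> 0 <= b -> (forall i, a ^+ i <= C * b ^+ i) -> a <= b.
Proof.
move=> a0 b0 abC; rewrite leNgt; apply/negP => ab.
have C1 : 1 <= C by have := abC 0; rewrite !expr0 mulr1.
have [b_eq0|b_neq0] := eqVneq b 0.
  by have := abC 1; rewrite !expr1 b_eq0 mulr0; move: ab; rewrite b_eq0; lra.
have b_gt0 : 0 < b by rewrite lt0r b_neq0.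
pose x := a / b - 1.
have x_gt0 : 0 < x by rewrite subr_gt0 ltr_pdivlMr// mul1r.
have xC i : 1 + x *+ i <= C.
  apply: le_trans (bernoulli_ler i (ltW x_gt0)) _.
  by rewrite /x addrC subrK expr_div_n ler_pdivrMr ?exprn_gt0.
have := xC (Num.bound (C / x)).
have : C / x < (Num.bound (C / x))%:R.
  by apply: le_lt_trans (archi_boundP _) => //; rewrite divr_ge0// ltW// (lt_le_trans ltr01).
rewrite ltr_pdivrMr// mulr_natl; lra.
Qed.

Lemma count_allpairs_le (S T U : Type) (f : S -> T -> U) (a : pred U)
    (b : pred S) (s : seq S) (t : seq T) (q : nat) :
  (forall x, count (fun y => a (f x y)) t <= q * b x)%N ->
  (count a [seq f x y | x <- s, y <- t] <= q * count b s)%N.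
Proof.
move=> fq; elim: s => [|x s IH] //=.
rewrite count_cat count_map mulnDr leq_add//; exact: fq.
Qed.

Lemma size_le_of_cover (S T : Type) (a : T -> pred S) (s : seq S) (t : seq T)
    (q : nat) :
  (forall z, count (a z) s <= q)%N -> all (fun x => has (a^~ x) t) s ->
  (size s <= size t * q)%N.
Proof.
elim: t s => [|z t IH] s aq.
  by rewrite mul0n; case: s {aq}.
move=> /= st; rewrite mulSn -(count_predC (a z) s) leq_add ?aq//.
rewrite -size_filter; apply: IH => [z'|].
  by rewrite count_filter; apply: leq_trans (aq z'); apply: sub_count => x /andP[].
rewrite all_filter; apply: sub_all st => x /=.
by case: (a z x).
Qed.

Section DenseBall.
Context {R : realType} {k : scalar_kind} {X : normedModType (scalars R k)}.
Variables (W : set X) (d : nat) (C : R).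
Hypothesis W0 : W 0.
Hypothesis WD : forall x y, W x -> W y -> W (x + y).
Hypothesis WZ : forall (a : scalars R k) x, W x -> W (a *: x).
(** Finite dimension enters only through the growth exponent [d]; [C] is arbitrary and does not
    appear in [dense_ball]. *)
Hypothesis W_cover : forall r s : R, 1 <= r -> 0 < s -> exists zs : seq X,
  (size zs)%:R <= C * r ^+ d /\
  forall x, W x -> rnorm x <= r * s -> exists2 z, z \in zs & rnorm (x - z) <= s.

Variables (pts : seq X) (rho s : R).
Hypotheses (rho_gt0 : 0 < rho) (s_gt0 : 0 < s).
Hypothesis ptsW : forall x, x \in pts -> W x /\ rnorm x <= rho.

Let lam : R := 1 + rho / s.
Let lam_gt1 : 1 < lam. Proof. by rewrite ltrDl divr_gt0. Qed.
Let lam_gt0 : 0 < lam. Proof. exact: lt_trans ltr01 lam_gt1. Qed.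

(** The sums [x_0 + lam x_1 + ... + lam^(i-1) x_(i-1)] with all [x_j] in [pts]. Repetitions are
    kept, so that there are exactly [size pts ^ i] entries. *)
Fixpoint self_similar_sums i : seq X :=
  if i is j.+1 then
    [seq x + of_real lam *: y | y <- self_similar_sums j, x <- pts]
  else [:: 0].

Let scalar_Re_lam : scalar_Re `|of_real lam : scalars R k| = lam.
Proof. by rewrite scalar_Re_norm_of_real// ltW. Qed.

(** A geometric series with ratio [lam] and first term [rho]; the choice of [lam] makes
    [rho = s * (lam - 1)]. *)
Lemma self_similar_sums_bound i y : y \in self_similar_sums i ->
  W y /\ rnorm y <= s * (lam ^+ i - 1).
Proof.
elim: i y => [|i IH] y /=.
  by rewrite inE => /eqP->; rewrite rnorm0 expr0 subrr mulr0.
move=> /allpairsP[[y' x] /= [/IH[Wy' y'i] /ptsW[Wx xrho] ->]].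
split; first exact: WD (WZ _ _).
apply: le_trans (rnormD _ _) _; rewrite rnormZ scalar_Re_lam.
apply: (@le_trans _ _ (rho + lam * (s * (lam ^+ i - 1)))).
  by rewrite lerD// ler_wpM2l// ltW.
have -> : rho = s * (lam - 1).
  by rewrite /lam addrAC subrr add0r mulrCA mulfV ?mulr1// gt_eqF.
by rewrite exprS; lra.
Qed.

(* If [x + lam * y] is in the [s]-ball around [z], then
   [rnorm (lam * y - z) <= s + rho = lam * s], so that [y] is in the [s]-ball
   around [z / lam]. *)
Lemma count_self_similar_sums q i (z : X) :
  (forall z' : X, count (fun x : X => (rnorm (x - z') <= s)%R) pts <= q)%N ->
  (count (fun x : X => (rnorm (x - z) <= s)%R) (self_similar_sums i) <= q ^ i)%N.
Proof.
move=> ptsq; elim: i z => [|i IH] z /=.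
  by rewrite addn0 expn0 leq_b1.
pose z' : X := (of_real lam)^-1 *: z.
rewrite expnS; apply: leq_trans (leq_mul (leqnn q) (IH z')).
apply: count_allpairs_le => y.
case: (leP (rnorm (y - z')) s) => yz'.
  rewrite muln1; apply: leq_trans (ptsq (z - of_real lam *: y)).
  by apply: sub_count => x /=; rewrite opprB addrA.
rewrite muln0 leqn0 eqn0Ngt -has_count; apply/hasPn => x /ptsW[_ xrho] /=.
rewrite -ltNge.
have lam_neq0 : of_real lam != 0 :> scalars R k.
  by rewrite -of_real0 (can_eq (@of_realK R k)) gt_eqF.
have zE : x + of_real lam *: y - z = x + of_real lam *: (y - z').
  by rewrite scalerBr /z' scalerA divff// scale1r addrA.
have : lam * s < rnorm (of_real lam *: (y - z')).
  by rewrite rnormZ scalar_Re_lam ltr_pM2l.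
have : rnorm (of_real lam *: (y - z')) <=
       rnorm (x + of_real lam *: y - z) + rnorm x.
  rewrite -[rnorm x]rnormN; apply: le_trans _ (rnormD _ _).
  by rewrite zE addrAC subrr add0r.
have -> : lam * s = s + rho by rewrite /lam mulrDl mul1r divfK// gt_eqF.
lra.
Qed.

(* This replaces the usual volume argument. If no [s]-ball contains more than [q] of
   the [N] points, then none contains more than [q ^ i] of the [N ^ i] sums of order
   [i]; as these lie in the ball of radius [s * lam ^ i], which is covered by
   [C * lam ^ (i * d)] balls of radius [s], it follows that
   [N ^ i <= C * (lam ^ d * q) ^ i] for all [i]. *)
Lemma dense_ball : exists z : X,
  (size pts)%:R <= (1 + rho / s) ^+ d *
                   (count (fun x : X => (rnorm (x - z) <= s)%R) pts)%:R.
Proof.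
(* The counts are at most [size pts], so some ball attains the largest count [q]; its center is the
   required [z]. *)
pose attained q := `[< exists z : X, count (fun x : X => (rnorm (x - z) <= s)%R) pts = q >].
have ex_att : exists q, attained q.
  by eexists; apply/asboolP; exists 0.
have att_le q : attained q -> (q <= size pts)%N.
  by move=> /asboolP[z <-]; exact: count_size.
case: (ex_maxnP ex_att att_le) => q /asboolP[z zq] q_max.
exists z; rewrite zq.
have ptsq (z' : X) : (count (fun x : X => (rnorm (x - z') <= s)%R) pts <= q)%N.
  by apply: q_max; apply/asboolP; exists z'.
apply: (@ler_of_expr_le_mul _ _ _ C) => //.
  by rewrite mulr_ge0// exprn_ge0// ltW.
move=> i; have [zs [zsC zs_cov]] := W_cover (exprn_ege1 i (ltW lam_gt1)) s_gt0.
have size_sums : size (self_similar_sums i) = (size pts ^ i)%N.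
  by elim: i {zsC zs_cov} => //= i IH; rewrite size_allpairs IH expnSr.
have : (size (self_similar_sums i) <= size zs * q ^ i)%N.
  apply: (size_le_of_cover (a := fun z' y => rnorm (y - z') <= s)).
    by move=> z'; exact: count_self_similar_sums.
  apply/allP => y /self_similar_sums_bound[Wy yi].
  have [||z' z'zs yz'] := zs_cov y => //; last by apply/hasP; exists z'.
  by apply: le_trans yi _; rewrite mulrC ler_pM2r// gerBl.
rewrite size_sums -(ler_nat R) natrX natrM natrX exprMn => le1.
apply: le_trans le1 _; rewrite -exprM mulnC exprM mulrA.
rewrite -!exprM mulnC exprM in zsC *.
by rewrite ler_wpM2r// exprn_ge0.
Qed.

End DenseBall.

(** * Orthonormal coordinates *)

Section ScalarGrid.
Context {R : realType}.

Lemma real_grid (r : R) : 1 <= r -> exists zs : seq R,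
  (size zs)%:R <= 4 * r /\
  forall a, `|a| <= r -> exists2 z, z \in zs & `|a - z| <= 1.
Proof.
move=> r1; pose G := Num.floor r.
have G0 : 0 <= G by rewrite floor_ge0 (le_trans ler01).
have NE : `|G|%N%:R = G%:~R :> R by rewrite -[G in RHS]gez0_abs.
have Gr : G%:~R <= r by exact: ge_floor.
(* These are the integers from [- G - 1] to [G], and [a] is approximated by its floor. Their number
   [2 * G + 2] is at most [4 * r] because [1 <= r]. *)
exists [seq j%:R - G%:~R - 1 | j <- iota 0 (2 * `|G| + 2)].
split; first by rewrite size_map size_iota natrD natrM NE; lra.
move=> a; rewrite ler_norml => /andP[ra ar].
have fa := ge_floor a; have := lt_succ_floor a; rewrite intrD1 => af.
have FG : Num.floor a <= G by exact: le_floor.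
have GF : - (G + 1) <= Num.floor a.
  have := lt_succ_floor r; rewrite -/G => rG.
  by rewrite floor_ge_int rmorphN /= lerNl ltW//; lra.
have jE : (`|(Num.floor a + G + 1)%R|%N)%:R = (Num.floor a + G + 1)%:~R :> R.
  by rewrite -[X in _ = X%:~R]gez0_abs//; lia.
exists ((`|(Num.floor a + G + 1)%R|%N)%:R - G%:~R - 1).
  by apply/mapP; exists `|(Num.floor a + G + 1)%R|%N => //; rewrite mem_iota; lia.
rewrite jE !intrD; move: fa af; set F := (Num.floor a)%:~R => fa af.
by rewrite ler_norml; apply/andP; split; lra.
Qed.

(** In the complex case, take the product of the grids for the real and imaginary parts; the error
    [sqrt 2] is rounded up to [2]. This is where the complex dimension gets doubled. *)
Lemma scalar_grid (k : scalar_kind) (r : R) : 1 <= r ->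
  exists zs : seq (scalars R k),
  (size zs)%:R <= (4 * r) ^+ real_dim k 1 /\
  forall a : scalars R k, scalar_Re `|a| <= r ->
    exists2 z, z \in zs & scalar_Re `|a - z| <= 2.
Proof.
move=> r1; have [zs [zs_size zs_cov]] := real_grid r1.
have normE (z : scalars R ComplexScalars) :
    scalar_Re `|z| = Num.sqrt (complex.Re z ^+ 2 + complex.Im z ^+ 2).
  exact: (congr1 (@complex.Re R) (normc_def (z : R[i]))).
case: k.
  exists zs; split; first by rewrite expr1.
  by move=> a /zs_cov[z zzs az]; exists z => //; apply: le_trans az _; lra.
exists [seq Complex x y | x <- zs, y <- zs]; split.
  by rewrite size_allpairs natrM -[real_dim _ _]/2%N expr2 ler_pM.
case=> x y; rewrite normE /= => xyr.
have [|x' x'zs xx'] := zs_cov x.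
  by apply: le_trans xyr; rewrite -sqrtr_sqr ler_wsqrtr// lerDl sqr_ge0.
have [|y' y'zs yy'] := zs_cov y.
  by apply: le_trans xyr; rewrite -sqrtr_sqr ler_wsqrtr// lerDr sqr_ge0.
exists (Complex x' y'); first exact: allpairs_f.
rewrite [leLHS](normE (Complex (x - x') (y - y'))).
rewrite /= -[leRHS]ger0_norm// -sqrtr_sqr ler_wsqrtr//.
rewrite -[X in X + _]real_normK ?num_real// -[X in _ + X]real_normK ?num_real//.
have := normr_ge0 (x - x'); have := normr_ge0 (y - y').
nra.
Qed.

End ScalarGrid.

Section Hilbert.
Context {R : realType} {k : scalar_kind} {X : normedModType (scalars R k)}.
Local Notation K := (scalars R k).
Variable ip : {dot X for @scalar_conj R k}.
Hypothesis ip_norm : norm_of_inner_product ip.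
Implicit Types x y z : X.

Lemma ip_conj x y : ip x y = scalar_conj (ip y x).
Proof. by rewrite [LHS]hermitian_subproof expr0 mul1r. Qed.

Lemma ip_addl z : {morph ip^~ z : x y / x + y}.
Proof. by move=> x y; rewrite linearDl. Qed.

Lemma ip_oppl z : {morph ip^~ z : x / - x}.
Proof. by move=> x; rewrite linearNl. Qed.

Lemma ip_scalel (a : K) x y : ip (a *: x) y = a * ip x y.
Proof. by rewrite linearZl_LR. Qed.

Lemma ip0l y : ip 0 y = 0.
Proof. by rewrite linear0l. Qed.

Lemma ip_scaler (a : K) x y : ip x (a *: y) = scalar_conj a * ip x y.
Proof. by rewrite ip_conj ip_scalel scalar_conjM -ip_conj. Qed.

Lemma ip_suml (I : Type) (s : seq I) (F : I -> X) y :
  ip (\sum_(i <- s) F i) y = \sum_(i <- s) ip (F i) y.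
Proof. exact: (big_morph (ip^~ y) (ip_addl y) (ip0l y)). Qed.

Lemma ip_eq0C x y : ip x y = 0 -> ip y x = 0.
Proof. by move=> xy0; rewrite ip_conj xy0 scalar_conj0. Qed.

Lemma pythagoras x y : ip x y = 0 -> rnorm (x + y) ^+ 2 = rnorm x ^+ 2 + rnorm y ^+ 2.
Proof.
move=> xy0; apply: (can_inj (@of_realK R k)).
rewrite !expr2 of_realD !of_realM !of_real_rnorm -!expr2 !ip_norm.
rewrite ip_addl [ip x (x + y)]ip_conj [ip y (x + y)]ip_conj !ip_addl.
by rewrite !scalar_conjD -!ip_conj xy0 (ip_eq0C xy0) addr0 add0r.
Qed.

(** Pythagoras for the component of [x] along [u] and the remainder. The case [u = 0] accommodates
    the output of [gram_schmidt]. *)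
Lemma cauchy_schwarz_unit x u : u = 0 \/ ip u u = 1 ->
  scalar_Re `|ip x u| <= rnorm x.
Proof.
case=> [->|u1].
  rewrite ip_conj ip0l scalar_conj0 normr0 -(of_real0 (k := k)) of_realK.
  exact: rnorm_ge0.
pose y := x - ip x u *: u.
have yu0 : ip y (ip x u *: u) = 0.
  by rewrite ip_scaler ip_addl ip_oppl ip_scalel u1 mulr1 subrr mulr0.
have := pythagoras yu0; rewrite subrK => xE.
have un : rnorm u = 1.
  have : rnorm u ^+ 2 = 1.
    apply: (can_inj (@of_realK R k)).
    by rewrite expr2 of_realM of_real_rnorm -expr2 ip_norm u1 of_real1.
  by move/eqP; rewrite sqrp_eq1 ?rnorm_ge0// => /eqP.
have nc : rnorm (ip x u *: u) = scalar_Re `|ip x u| by rewrite rnormZ un mulr1.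
rewrite -nc -(ler_pXn2r (n := 2)) ?nnegrE ?rnorm_ge0//.
by rewrite xE lerDr exprn_ge0// rnorm_ge0.
Qed.

(** Induction on [n]: the residual [v] of [e n] is normalized to [w]. If [v = 0], then [w = 0],
    which is the first alternative for [u i], and [ip v w *: w = v] remains true. *)
Lemma gram_schmidt (e : nat -> X) (n : nat) : exists u : nat -> X,
  [/\ forall i j, (i < n)%N -> (j < n)%N -> i != j -> ip (u i) (u j) = 0,
      forall i, (i < n)%N -> u i = 0 \/ ip (u i) (u i) = 1
    & forall i, (i < n)%N -> e i = \sum_(j < n) ip (e i) (u j) *: u j].
Proof.
elim: n => [|n [u [u_orth u_norm u_span]]]; first by exists (fun=> 0).
pose v := e n - \sum_(j < n) ip (e n) (u j) *: u j.
have vu0 l : (l < n)%N -> ip v (u l) = 0.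
  move=> ln; rewrite ip_addl ip_oppl ip_suml (bigD1 (Ordinal ln))//= big1 => [|j jl].
    rewrite addr0 ip_scalel; case: (u_norm l ln) => [->|->].
      by rewrite ip_conj ip0l scalar_conj0 mul0r subrr.
    by rewrite mulr1 subrr.
  by rewrite ip_scalel u_orth ?mulr0.
pose w := of_real (rnorm v)^-1 *: v.
have wu0 l : (l < n)%N -> ip w (u l) = 0.
  by move=> ln; rewrite ip_scalel vu0 ?mulr0.
pose u' j := if j == n then w else u j.
have u'n : u' n = w by rewrite /u' eqxx.
have u'E j : (j < n)%N -> u' j = u j by rewrite /u'; case: eqP => // ->; rewrite ltnn.
have vw : ip v w *: w = v.
  rewrite ip_scaler scalar_conj_of_real /w scalerA mulrAC -of_realM -ip_norm.
  rewrite -of_real_rnorm expr2 -!of_realM.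
  have [v0|v0] := eqVneq (rnorm v) 0; first by rewrite (rnorm_eq0 v0) scaler0.
  rewrite (_ : _ * _ = 1) ?of_real1 ?scale1r//; field; exact: v0.
exists u'; split => [i j|i|i].
- rewrite ltnS leq_eqVlt => /predU1P[->|i_n]; rewrite ltnS leq_eqVlt => /predU1P[->|jn].
  + by rewrite eqxx.
  + by move=> _; rewrite u'n u'E// wu0.
  + by move=> _; rewrite u'n u'E//; apply: ip_eq0C; rewrite wu0.
  + by move=> ij; rewrite !u'E// u_orth.
- rewrite ltnS leq_eqVlt => /predU1P[->|i_n]; last by rewrite u'E//; exact: u_norm.
  rewrite u'n; have [v0|v0] := eqVneq (rnorm v) 0.
    by left; rewrite /w (rnorm_eq0 v0) scaler0.
  right; rewrite /w ip_scalel ip_scaler scalar_conj_of_real -ip_norm.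
  rewrite -of_real_rnorm expr2 -!of_realM.
  by rewrite (_ : _ * _ = 1) ?of_real1//; field; exact: v0.
- rewrite big_ord_recr/= u'n.
  under eq_bigr => j _ do rewrite u'E//.
  rewrite ltnS leq_eqVlt => /predU1P[->|i_n].
    have enE : e n = v + \sum_(j < n) ip (e n) (u j) *: u j by rewrite subrK.
    have -> : ip (e n) w = ip v w.
      rewrite {1}enE ip_addl ip_suml big1 ?addr0// => j _.
      by rewrite ip_scalel (ip_eq0C (wu0 j _)) ?mulr0.
    by rewrite vw addrC subrK.
  have -> : ip (e i) w = 0.
    rewrite (u_span i i_n) ip_suml big1// => j _.
    by rewrite ip_scalel (ip_eq0C (wu0 j _)) ?mulr0.
  by rewrite scale0r addr0 -u_span.
Qed.

End Hilbert.

(** * Coordinates and covers of a finite-dimensional subspace *)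

Section Subspace.
Context {R : realType} {k : scalar_kind} {X : normedModType (scalars R k)}.
Local Notation K := (scalars R k).
Variables (n : nat) (Xn : set X).
Hypothesis Xn_dim : is_subspace_of_dim n Xn.

Lemma subspace0 : Xn 0.
Proof.
have [e [_ ->]] := Xn_dim; exists (fun=> 0) => //.
by rewrite big1// => i _; rewrite scale0r.
Qed.

Lemma subspaceD x y : Xn x -> Xn y -> Xn (x + y).
Proof.
have [e [_ ->]] := Xn_dim => -[c _ <-] [c' _ <-].
exists (fun i => c i + c' i) => //.
by rewrite -big_split/=; apply: eq_bigr => i _; rewrite scalerDl.
Qed.

Lemma subspaceZ (a : K) x : Xn x -> Xn (a *: x).
Proof.
have [e [_ ->]] := Xn_dim => -[c _ <-]; exists (fun i => a * c i) => //.
by rewrite scaler_sumr; apply: eq_bigr => i _; rewrite scalerA.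
Qed.

Lemma subspaceB x y : Xn x -> Xn y -> Xn (x - y).
Proof. by move=> Xx Xy; rewrite -scaleN1r; apply: subspaceD => //; exact: subspaceZ. Qed.

Variable ip : {dot X for @scalar_conj R k}.
Hypothesis ip_norm : norm_of_inner_product ip.

(** The [u i] come from Gram-Schmidt and the coordinates are [ip x (u i)], which Cauchy-Schwarz
    bounds by the norm of [x]. *)
Lemma unit_coordinates : exists u : 'I_n -> X,
  (forall i, rnorm (u i) <= 1) /\
  forall x, Xn x -> exists2 c : 'I_n -> K,
    (forall i, scalar_Re `|c i| <= rnorm x) & x = \sum_(i < n) c i *: u i.
Proof.
have [e [_ XnE]] := Xn_dim.
pose e' j := oapp e 0 (insub j : option 'I_n).
have e'E (i : 'I_n) : e' i = e i by rewrite /e' valK.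
have [u [_ u_norm u_span]] := gram_schmidt ip_norm e' n.
exists (fun i => u i); split => [i|x].
  case: (u_norm i (ltn_ord i)) => [->|u1]; first by rewrite rnorm0.
  have : rnorm (u i) ^+ 2 = 1.
    apply: (can_inj (@of_realK R k)).
    by rewrite expr2 of_realM of_real_rnorm -expr2 ip_norm u1 of_real1.
  by move/eqP; rewrite sqrp_eq1 ?rnorm_ge0// => /eqP->.
rewrite XnE => -[a _ xE]; exists (fun i => ip x (u i)).
  by move=> i; apply: cauchy_schwarz_unit => //; exact: u_norm.
rewrite -{1}xE -xE.
transitivity (\sum_(i < n) a i *: \sum_(j < n) ip (e i) (u j) *: u j).
  by apply: eq_bigr => i _; rewrite -!e'E -u_span.
under eq_bigr do rewrite scaler_sumr.
rewrite exchange_big/=; apply: eq_bigr => j _.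
rewrite ip_suml scaler_suml; apply: eq_bigr => i _.
by rewrite ip_scalel scalerA.
Qed.

Lemma rnorm_sum (I : finType) (F : I -> X) :
  rnorm (\sum_i F i) <= \sum_i rnorm (F i).
Proof.
elim/big_ind2: _ => [|x a y b xa yb|//]; first by rewrite rnorm0.
by apply: le_trans (rnormD _ _) _; exact: lerD.
Qed.

(** Each coordinate is rounded to a scaled scalar grid. The constant is crude, but it only plays the
    part of [C] in [dense_ball]. *)
Lemma subspace_cover (r s : R) : 1 <= r -> 0 < s -> exists zs : seq X,
  (size zs)%:R <= (8 * n.+1%:R) ^+ real_dim k n * r ^+ real_dim k n /\
  forall x, Xn x -> rnorm x <= r * s -> exists2 z, z \in zs & rnorm (x - z) <= s.
Proof.
move=> r1 s0; have [u [u1 u_span]] := unit_coordinates.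
have n1 : 1 <= n.+1%:R :> R by rewrite ler1n.
have nr1 : 1 <= 2 * n.+1%:R * r.
  have : 1 * 1 <= n.+1%:R * r by rewrite ler_pM.
  lra.
have [zs [zs_size zs_cov]] := scalar_grid k nr1.
(* Coordinates divided by [del] have modulus at most [2 * n.+1 * r]. Rounding each within [2 * del]
   costs [s * (n / n.+1)] in total; [n.+1] also covers [n = 0]. *)
pose del := s / (2 * n.+1%:R).
have del0 : 0 < del by rewrite divr_gt0//; lra.
pose pt (f : {ffun 'I_n -> 'I_(size zs)}) : X :=
  \sum_(i < n) (of_real del * nth 0 zs (f i)) *: u i.
exists [seq pt f | f <- enum {: {ffun 'I_n -> 'I_(size zs)}}]; split.
  rewrite size_map -cardE card_ffun !card_ord natrX.
  have -> : real_dim k n = (real_dim k 1 * n)%N by case: k => /=; lia.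
  rewrite -exprMn exprM lerXn2r ?nnegrE ?exprn_ge0//; first by rewrite !mulr_ge0//; lra.
  by rewrite (_ : _ * r = 4 * (2 * n.+1%:R * r))//; lra.
move=> x Xx xr; have [c c_le xE] := u_span x Xx.
have scaleE (a : K) : scalar_Re `|of_real del * a| = del * scalar_Re `|a|.
  by rewrite scalar_Re_normM scalar_Re_norm_of_real// ltW.
have delK a : of_real del * (of_real del^-1 * a) = a :> K.
  by rewrite mulrA -of_realM mulfV ?gt_eqF// of_real1 mul1r.
have c_grid i : exists j : 'I_(size zs),
    scalar_Re `|of_real del^-1 * c i - nth 0 zs j| <= 2.
  have [|z zzs cz] := zs_cov (of_real del^-1 * c i).
    rewrite -(ler_pM2l del0) -scaleE delK; apply: le_trans (c_le i) _.
    apply: le_trans xr _; rewrite /del le_eqVlt; apply/orP; left; apply/eqP.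
    by field; rewrite ?pnatr_eq0//; lra.
  have zi : (index z zs < size zs)%N by rewrite index_mem.
  by exists (Ordinal zi); rewrite /= nth_index.
have [f fP] := choice c_grid.
exists (pt (finfun f)); first by apply/map_f; rewrite mem_enum.
rewrite xE /pt -sumrB; apply: le_trans (rnorm_sum _) _.
apply: (@le_trans _ _ (\sum_(i < n) del * 2)).
  apply: ler_sum => i _; rewrite -scalerBl rnormZ ffunE.
  rewrite -{1}(delK (c i)) -mulrBr scaleE -[leRHS]mulr1.
  rewrite ler_pM ?rnorm_ge0// ?ler_pM2l//.
  by rewrite mulr_ge0 ?scalar_Re_norm_ge0// ltW.
rewrite sumr_const card_ord -[leLHS]mulr_natr /del.
have -> : s / (2 * n.+1%:R) * 2 * n%:R = s * (n%:R / n.+1%:R).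
  by field; rewrite addrC natr1 pnatr_eq0.
by rewrite ger_pMr// ler_pdivrMr ?mul1r ?ler_nat// ltr0Sn.
Qed.

End Subspace.

(** * The covering estimate *)

Lemma iter_invariant (T : Type) (f : T -> T) (D : set T) :
  (forall x, D x -> D (f x)) -> forall m x, D x -> D (iter m f x).
Proof. by move=> fD m x Dx; elim: m => //= m; exact: fD. Qed.

Section Covering.
Context {R : realType} {k : scalar_kind} {X : normedModType (scalars R k)}.
Variable ip : {dot X for @scalar_conj R k}.
Hypothesis ip_norm : norm_of_inner_product ip.
Variables (n : nat) (Xn : set X) (P : X -> X).
Hypothesis Xn_dim : is_subspace_of_dim n Xn.
Hypothesis P_proj : is_orthogonal_projection ip P Xn.
Variables (f : X -> X) (D : set X) (eta kappa sigma : R).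
Hypotheses (eta_ge0 : 0 <= eta) (kappa_gt0 : 0 < kappa) (sigma_gt0 : 0 < sigma).
Hypothesis f_ladyzhenskaya : forall x y, D x -> D y ->
  rnorm ((f x - P (f x)) - (f y - P (f y))) <= eta * rnorm (x - y) /\
  rnorm (P (f x) - P (f y)) <= kappa * rnorm (x - y).

Let theta := Num.sqrt (sigma ^+ 2 + eta ^+ 2).
Let h := (1 + 2 * kappa / sigma) ^+ real_dim k n.

(** [x - P x] and [y - P y] are both orthogonal to [P x - P y], which lies in [Xn]. *)
Lemma rnorm_proj_pythagoras x y :
  rnorm (x - y) ^+ 2 =
  rnorm ((x - P x) - (y - P y)) ^+ 2 + rnorm (P x - P y) ^+ 2.
Proof.
rewrite -(@pythagoras _ _ _ ip)//.
  by congr (rnorm _ ^+ 2); rewrite opprB addrACA addrNK [P y - y]addrC addrK.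
have Pxy : Xn (P x - P y).
  by apply: (subspaceB Xn_dim); [have [] := P_proj x|have [] := P_proj y].
have [_ /(_ _ Pxy) x0] := P_proj x; have [_ /(_ _ Pxy) y0] := P_proj y.
by rewrite ip_addl ip_oppl x0 y0 subrr.
Qed.

(** [dense_ball] is applied with [rho = kappa * r] and [s = sigma * r / 2]: in the ratio [r]
    cancels, which leaves [h], and the retained projections are at mutual distances at most
    [sigma * r]. *)
Lemma contraction_step (A : seq X) (r : R) : 0 < r ->
  (forall x, x \in A -> D x) ->
  (forall x y, x \in A -> y \in A -> rnorm (x - y) <= r) ->
  exists a : pred X, (size A)%:R <= h * (count a A)%:R /\
    forall x y, x \in A -> y \in A -> a x -> a y ->
      rnorm (f x - f y) <= theta * r.
Proof.
move=> r0 AD Ar; case: A AD Ar => [|x0 A'] AD Ar.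
  by exists xpred0; split => //=; rewrite mulr0.
move: AD Ar; set A := x0 :: A' => AD Ar.
have x0A : x0 \in A by rewrite mem_head.
(* Centering at a member of [A] puts the projections in a ball around 0. In [map pt A] coinciding
   projections are repeated, so proportions are those of [A]. *)
pose pt x := P (f x) - P (f x0).
have ptsW y : y \in map pt A -> Xn y /\ rnorm y <= kappa * r.
  move=> /mapP[x xA ->]; split.
    by apply: (subspaceB Xn_dim); [have [] := P_proj (f x)|have [] := P_proj (f x0)].
  have [_] := f_ladyzhenskaya (AD _ xA) (AD _ x0A); move/le_trans; apply.
  by rewrite ler_pM2l// Ar.
have s0 : 0 < sigma * r / 2 by rewrite divr_gt0// mulr_gt0.
have [z] := dense_ball (subspace0 Xn_dim) (subspaceD Xn_dim)
  (@subspaceZ _ _ _ _ _ Xn_dim) (subspace_cover Xn_dim ip_norm)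
  (mulr_gt0 kappa_gt0 r0) s0 ptsW.
rewrite size_map count_map => Az.
exists (fun x => rnorm (pt x - z) <= sigma * r / 2); split.
  apply: le_trans Az _; rewrite le_eqVlt; apply/orP; left; apply/eqP.
  congr (_ ^+ _ * _); congr (_ + _); field.
  by rewrite !gt_eqF.
move=> x y xA yA xz yz.
have Pxy : rnorm (P (f x) - P (f y)) <= sigma * r.
  have -> : P (f x) - P (f y) = (pt x - z) + (z - pt y).
    by rewrite /pt addrA addrNK opprB addrA addrNK.
  apply: le_trans (rnormD _ _) _; rewrite rnormB [X in _ + X]rnormB.
  by move: xz yz; rewrite rnormB; lra.
have [Qxy _] := f_ladyzhenskaya (AD _ xA) (AD _ yA).
have {}Qxy : rnorm (f x - P (f x) - (f y - P (f y))) <= eta * r.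
  by apply: le_trans Qxy _; rewrite ler_wpM2l// Ar.
rewrite -(ler_pXn2r (n := 2)) ?nnegrE ?rnorm_ge0 ?mulr_ge0 ?sqrtr_ge0 ?(ltW r0)//.
rewrite exprMn sqr_sqrtr ?addr_ge0 ?sqr_ge0// rnorm_proj_pythagoras mulrDl.
by rewrite -!exprMn [leRHS]addrC lerD// lerXn2r// ?nnegrE ?rnorm_ge0// mulr_ge0// ltW.
Qed.

Hypothesis fD : forall x, D x -> D (f x).

Let theta_gt0 : 0 < theta.
Proof. by rewrite sqrtr_gt0 ltr_pwDl ?exprn_gt0 ?sqr_ge0. Qed.

Let h_ge1 : 1 <= h.
Proof. by rewrite exprn_ege1// lerDl divr_ge0 ?mulr_ge0// ltW. Qed.

Lemma contraction_iter (m : nat) (A : seq X) (r : R) : 0 < r ->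
  (forall x, x \in A -> D x) ->
  (forall x y, x \in A -> y \in A -> rnorm (x - y) <= r) ->
  exists a : pred X, (size A)%:R <= h ^+ m * (count a A)%:R /\
    forall x y, x \in A -> y \in A -> a x -> a y ->
      rnorm (iter m f x - iter m f y) <= theta ^+ m * r.
Proof.
move=> r0 AD Ar; elim: m => [|m [a [Aa a_close]]].
  exists xpredT; rewrite count_predT !expr0 !mul1r; split=> // x y xA yA _ _.
  exact: Ar.
(* The step is applied to the images of the points retained so far, whereas the selection stays a
   predicate on the initial points. *)
pose B : seq X := map (iter m f) [seq x <- A | a x].
have BD y : y \in B -> D y.
  by move=> /mapP[x]; rewrite mem_filter => /andP[_ xA] ->; apply: iter_invariant fD _ _ (AD _ xA).
have Br (x y : X) : x \in B -> y \in B -> rnorm (x - y) <= theta ^+ m * r.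
  move=> /mapP[x']; rewrite mem_filter => /andP[ax' x'A] ->.
  move=> /mapP[y']; rewrite mem_filter => /andP[ay' y'A] ->.
  exact: a_close.
have [b [Bb b_close]] := contraction_step (mulr_gt0 (exprn_gt0 m theta_gt0) r0) BD Br.
exists (fun x => b (iter m f x) && a x); split.
  apply: le_trans Aa _; rewrite exprSr -mulrA ler_wpM2l ?(exprn_ge0 _ (le_trans ler01 h_ge1))//.
  by move: Bb; rewrite size_map size_filter count_map count_filter.
move=> x y xA yA /andP[bx ax] /andP[b_y ay].
rewrite exprS -mulrA; apply: b_close => //.
  by apply: map_f; rewrite mem_filter ax.
by apply: map_f; rewrite mem_filter ay.
Qed.

(* A [theta ^+ m * r]-separated set has at most [h ^+ m] points, because the
   preceding lemma leaves a single one of them. *)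
Lemma iter_cover (m : nat) (r : R) : 0 < r ->
  (forall x y, D x -> D y -> rnorm (x - y) <= r) ->
  exists E : seq X, [/\ forall e, e \in E -> D e, (size E)%:R <= h ^+ m
    & forall x, D x -> exists2 e, e \in E &
        rnorm (iter m f x - iter m f e) <= theta ^+ m * r].
Proof.
move=> r0 Dr.
pose separated (A : seq X) := [/\ uniq A, forall x, x \in A -> D x
  & forall x y, x \in A -> y \in A -> x != y ->
      theta ^+ m * r < rnorm (iter m f x - iter m f y)].
have sep_size A : separated A -> (size A)%:R <= h ^+ m.
  move=> [A_uniq AD A_sep].
  have Ar x y : x \in A -> y \in A -> rnorm (x - y) <= r by move=> /AD Dx /AD; exact: Dr.
  have [a [Aa a_close]] := contraction_iter m r0 AD Ar.
  apply: le_trans Aa _; rewrite ger_pMr ?(exprn_gt0 _ (lt_le_trans ltr01 h_ge1))// lern1.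
  rewrite -size_filter.
  have : uniq [seq x <- A | a x] by rewrite filter_uniq.
  case Efil : [seq x <- A | a x] => [|x [|y s]] //= /andP[]; rewrite inE negb_or => /andP[xy _] _.
  have /andP[ax xA] : a x && (x \in A) by rewrite -mem_filter Efil mem_head.
  have /andP[ay yA] : a y && (y \in A) by rewrite -mem_filter Efil !inE eqxx orbT.
  by have := A_sep x y xA yA xy; rewrite ltNge a_close.
(* Sizes of separated lists are bounded, so a largest one exists. Its maximality makes it a net: a
   point far from it could be added. *)
pose size_att N := `[< exists2 A, separated A & size A = N >].
have att0 : exists N, size_att N by exists 0%N; apply/asboolP; exists [::].
have att_le N : size_att N -> (N <= Num.bound (h ^+ m))%N.
  move=> /asboolP[A /sep_size Ah <-]; rewrite -(ler_nat R).
  apply: le_trans Ah (ltW _); apply: archi_boundP.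
  by rewrite exprn_ge0// (le_trans ler01 h_ge1).
case: (ex_maxnP att0 att_le) => N /asboolP[E E_sep EN] N_max.
exists E; split => [e||x Dx]; [by case: E_sep => _ + _; apply|exact: sep_size|].
apply: contrapT => /forall2NP x_far.
have {}x_far e : e \in E -> theta ^+ m * r < rnorm (iter m f x - iter m f e).
  by move=> eE; case: (x_far e) => [//|/negP]; rewrite -ltNge.
have : (size (x :: E) <= N)%N.
  apply: N_max; apply/asboolP; exists (x :: E) => //.
  case: E_sep => E_uniq ED E_sep; split.
  - rewrite /= E_uniq andbT; apply/negP => /x_far.
    by rewrite subrr rnorm0 ltNge mulr_ge0 ?exprn_ge0 ?ltW.
  - by move=> y; rewrite inE => /predU1P[->//|]; exact: ED.
  - move=> y z; rewrite !inE => /predU1P[->|yE] /predU1P[->|zE].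
    + by rewrite eqxx.
    + by move=> _; exact: x_far.
    + by move=> _; rewrite rnormB; exact: x_far.
    + exact: E_sep.
by rewrite /= EN ltnn.
Qed.

End Covering.

(** * Compactness and fractal dimension *)

(** The bound [ln y <= y] at [y = delta * x]. With [delta] small it makes polynomial factors of
    covering numbers negligible for the dimension. *)
Lemma ln_le_linear (R : realType) (delta x : R) : 0 < delta -> 0 < x ->
  ln x <= delta * x - ln delta.
Proof.
move=> d0 x0; have /ltW := ln_sublinear (mulr_gt0 d0 x0).
by rewrite lnM ?posrE// addrC -lerBrDr.
Qed.

Section MetricTopology.
Context {R : realType} {k : scalar_kind}.

Lemma closure_rnormP (X : normedModType (scalars R k)) (A : set X) x :
  closure A x <-> forall e : R, 0 < e -> exists2 y, A y & rnorm (x - y) < e.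
Proof.
split=> [Ax e e0|Ax U /nbhs_rnormP[e e0 eU]].
  have [|y [Ay xy]] := Ax [set y | rnorm (x - y) < e]; last by exists y.
  by apply/nbhs_rnormP; exists e.
by have [y Ay xy] := Ax e e0; exists y; split => //; exact: eU.
Qed.

(** An ultrafilter containing [M] contains one ball of every finite cover, hence is Cauchy and
    converges by completeness; the limit is in [M] by closedness. *)
Lemma totally_bounded_compact (X : completeNormedModType (scalars R k))
    (M : set X) :
  closed M ->
  (forall e : R, 0 < e -> exists zs : seq X,
    forall x, M x -> exists2 z, z \in zs & rnorm (z - x) < e) ->
  compact M.
Proof.
move=> M_closed M_cov; rewrite compact_ultra => F F_ultra FM.
have F_proper := @ultra_proper _ F F_ultra.
have F_cauchy : cauchy F.
  apply: cauchy_exP => e /= e0.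
  have eR : of_real (scalar_Re e) = e by rewrite of_real_Re// gtr0_real.
  have [|zs zs_cov] := M_cov (scalar_Re e).
    by rewrite -(@ltr_of_real _ k) eR of_real0.
  have : F [set x | exists2 z, z \in zs & rnorm (z - x) < scalar_Re e].
    by apply: filterS FM => x Mx; exact: zs_cov.
  elim: {zs_cov} zs => [|z zs IH] Fzs.
    have [] := filter_not_empty F.
    by apply: filterS Fzs => x [].
  have [Fz|Fz] := in_ultra_setVsetC [set x | rnorm (z - x) < scalar_Re e] F_ultra.
    exists z; apply: filterS Fz => x /= zx.
    rewrite -ball_normE /ball_/= -of_real_rnorm -eR ltr_of_real.
    exact: zx.
  apply: IH; apply: filterS (filterI Fz Fzs) => x [/= zx [z']].
  by rewrite inE => /predU1P[->//|z'zs z'x]; exists z'.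
have Fp : F --> lim F by exact: cauchy_cvg.
exists (lim F); split => //; apply: M_closed => U pU.
have [x [Mx Ux]] := filter_ex (filterI FM (Fp _ pU)).
by exists x.
Qed.

Variable X : normedModType (scalars R k).

(** With [t = ln (1 / eps)] and [m] about [(t + ln r) / a], the logarithm of the cover size is at
    most [m * ln h + 2 * ln m.+1], and its quotient by [t] has upper limit at most [ln h / a]. *)
Lemma fractal_dim_le (M : set X) (h theta r : R) :
  1 <= h -> 0 < theta < 1 -> 0 < r ->
  (forall m eps, theta ^+ m * r < eps -> exists2 N : nat,
    N%:R <= m.+1%:R ^+ 2 * h ^+ m & is_ball_cover M eps N) ->
  (fractal_dim M <= (ln h / ln (1 / theta))%:E)%E.
Proof.
move=> h1 /andP[theta0 theta1] r0 M_cov.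
set a := ln (1 / theta).
have a_def : a = - ln theta by rewrite /a div1r lnV ?posrE.
have a0 : 0 < a by rewrite a_def oppr_gt0 ln_lt0// theta0.
have h0 : 0 < h by exact: lt_le_trans h1.
have lnh0 : 0 <= ln h by exact: ln_ge0.
apply/lee_addgt0Pr => e e0.
(* The error [e * t] is split in halves. [delta] makes the part of [2 * ln m.+1] linear in [t] equal
   to [e * t / 2]; [C] dominates the terms free of [t], and [t0 < t] gives [C <= e * t / 2], besides
   [0 < t] and [0 <= t + c]. *)
pose delta := e * a / 4.
have delta0 : 0 < delta by rewrite divr_gt0// mulr_gt0.
pose c := ln r.
pose C := `|(2 * delta + ln h) * (c / a + 2) - 2 * ln delta|.
pose t0 := `|c| + 1 + 2 * C / e.
pose V := [set eps : R | 0 < eps < expR (- t0)].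
have V_near : (0 : R)^'+ V.
  rewrite /at_right /within /=; near=> eps => eps0 /=.
  by rewrite /V/= eps0/=; near: eps; apply: lt_nbhsl; exact: expR_gt0.
(* The upper limit is an infimum over neighborhoods of suprema, so a bound on the single
   neighborhood [V] suffices. *)
apply: (@le_trans _ _ (ereal_sup [set (lne (covering_number M eps) *
    ((ln (1 / eps))^-1)%:E)%E | eps in V])).
  by apply: ereal_inf_lbound; exists V.
apply: ge_ereal_sup => _ [eps /andP[eps0 eps_lt] <-].
set t := ln (1 / eps).
have t_def : t = - ln eps by rewrite /t div1r lnV ?posrE.
have C0 : 0 <= C by exact: normr_ge0.
have Ce0 : 0 <= 2 * C / e by rewrite divr_ge0 ?mulr_ge0// ltW.
have tt0 : t0 < t.
  by rewrite t_def ltrNr -(expRK (- t0)) ltr_ln ?posrE ?expR_gt0.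
have tc : 0 <= t + c.
  by have := lerNnormlW (lexx `|c|); move: tt0; rewrite /t0; lra.
have t_gt0 : 0 < t by have := normr_ge0 c; move: tt0; rewrite /t0; lra.
pose q := (t + c) / a.
have q0 : 0 <= q by rewrite divr_ge0// ltW.
have [m mq qm] : exists2 m : nat, q < m%:R & m%:R <= q + 1.
  exists (Num.truncn q).+1; first exact: truncnS_gt.
  by rewrite -natr1 lerD2r truncn_le.
have theta_m : theta ^+ m * r < eps.
  rewrite -ltr_ln ?posrE ?mulr_gt0 ?exprn_gt0//.
  rewrite lnM ?posrE ?exprn_gt0// lnXn// -mulr_natr.
  move: mq; rewrite /q ltr_pdivrMr// a_def t_def /c; lra.
have [N N_le N_cov] := M_cov m eps theta_m.
pose B := m.+1%:R ^+ 2 * h ^+ m.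
have B0 : 0 < B by rewrite mulr_gt0 ?exprn_gt0.
have cov_le : (covering_number M eps <= B%:E)%E.
  by apply: (@le_trans _ _ N%:R%:E); [apply: ereal_inf_lbound; exists N|rewrite lee_fin].
have lne_le : (lne (covering_number M eps) <= (ln B)%:E)%E.
  case: (covering_number M eps) cov_le => [x|//|_]; last by rewrite leNye.
  rewrite lee_fin => xB /=; case: ifPn; first by rewrite leNye.
  by rewrite -ltNge => x0; rewrite lee_fin ler_ln.
apply: (@le_trans _ _ ((ln B)%:E * (t^-1)%:E)%E).
  by rewrite lee_wpmul2r// lee_fin invr_ge0 ltW.
rewrite -EFinM -EFinD lee_fin ler_pdivrMr//.
have -> : ln B = 2 * ln m.+1%:R + m%:R * ln h.
  rewrite /B lnM ?posrE ?exprn_gt0// !lnXn//.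
  by rewrite -[ln h *+ m]mulr_natl -[_ *+ 2]mulr_natl.
have ln_m : ln m.+1%:R <= delta * m.+1%:R - ln delta by exact: ln_le_linear.
have m_le : m.+1%:R <= q + 2 by rewrite -natr1; lra.
have dm : delta * m.+1%:R <= delta * (q + 2) by rewrite ler_pM2l.
have hm : m%:R * ln h <= (q + 2) * ln h by rewrite ler_wpM2r//; lra.
have CE := ler_norm ((2 * delta + ln h) * (c / a + 2) - 2 * ln delta).
rewrite -/C in CE.
have qE : q = t / a + c / a by rewrite /q mulrDl.
have dE : delta * (t / a) = e * t / 4 by rewrite /delta; field; rewrite gt_eqF.
have Ct : 2 * C <= e * t.
  move: tt0; rewrite /t0 => tt0; rewrite [leRHS]mulrC -ler_pdivrMr//.
  by have := normr_ge0 c; lra.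
have -> : (ln h / a + e) * t = ln h * (t / a) + e * t by field; rewrite gt_eqF.
rewrite qE in dm hm.
have dE2 : delta * (t / a + c / a + 2) = e * t / 4 + delta * (c / a + 2).
  by rewrite -dE; lra.
rewrite dE2 in dm.
move: CE Ct ln_m dm hm.
set u := t / a; set v := c / a; set l := ln h; set et := e * t.
lra.
Unshelve. all: by end_near.
Qed.

End MetricTopology.

(** * The closure of the orbits of the centers *)

Section DiscreteAttractor.
Context {R : realType} {k : scalar_kind}.
Context {X : completeNormedModType (scalars R k)}.
Variables (f : X -> X) (D : set X) (E : nat -> seq X) (theta r : R).
Hypothesis fD : forall x, D x -> D (f x).
Hypothesis ED : forall m e, e \in E m -> D e.
Hypothesis E_cover : forall m x, D x ->
  exists2 e, e \in E m & rnorm (iter m f x - iter m f e) <= theta ^+ m * r.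

(** The centers of level [m] are the points [iter m f e] with [e] in [E m], not the points of [E m]
    themselves; [j] counts the further iterations along their orbits. *)
Definition net_orbits : set X :=
  [set y | exists m j e, e \in E m /\ y = iter (j + m) f e].

Definition net_orbits_upto m : seq X :=
  flatten [seq [seq iter (j + i) f e | j <- iota 0 m.+1, e <- E i]
          | i <- iota 0 m.+1].

Lemma net_orbits_sub : net_orbits `<=` D.
Proof. by move=> _ [m [j [e [/ED De ->]]]]; exact: iter_invariant. Qed.

Lemma net_orbits_f y : net_orbits y -> net_orbits (f y).
Proof. by move=> [m [j [e [eE ->]]]]; exists m, j.+1, e. Qed.

Lemma net_orbits_upto_sub m y : y \in net_orbits_upto m -> net_orbits y.
Proof.
move=> /flatten_mapP[i _ /allpairsP[[j e] /= [_ eE ->]]].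
by exists i, j, e.
Qed.

(** If level and further iterations add up to less than [m], both are at most [m], so the point is
    in the finite list; otherwise at least [m] iterations were made. *)
Lemma net_orbits_uptoP m y : net_orbits y ->
  y \in net_orbits_upto m \/ exists2 x, D x & y = iter m f x.
Proof.
move=> [i [j [e [eE ->]]]]; have [m_le|m_gt] := leqP m (j + i); last first.
  left; apply/flatten_mapP; exists i; first by rewrite mem_iota; lia.
  by apply/allpairsP; exists (j, e); rewrite mem_iota /=; split => //; lia.
right; exists (iter (j + i - m) f e); first exact: iter_invariant fD _ _ (ED eE).
by rewrite -iterD subnKC.
Qed.

Lemma net_orbits_upto_cover m x : D x -> exists2 z, z \in net_orbits_upto m &
  rnorm (iter m f x - z) <= theta ^+ m * r.
Proof.
move=> /(E_cover m)[e eE xe]; exists (iter m f e) => //.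
apply/flatten_mapP; exists m; first by rewrite mem_iota; lia.
by apply/allpairsP; exists (0%N, e); rewrite mem_iota.
Qed.

Definition net_attractor : set X := closure net_orbits.

Lemma net_attractor_attracts m x : D x ->
  exists2 z, net_attractor z & rnorm (iter m f x - z) <= theta ^+ m * r.
Proof.
move=> /(net_orbits_upto_cover m)[z /net_orbits_upto_sub Qz xz].
by exists z => //; exact: subset_closure.
Qed.

(* Only finitely many points of [net_orbits] are not in [iter m f @` D]. *)
Lemma net_attractor_split x : net_attractor x ->
  D x \/ forall m (e : R), 0 < e -> exists2 y, D y & rnorm (x - iter m f y) < e.
Proof.
move=> Mx; have [Dx|Dx] := pselect (D x); [by left|right => m].
(* A point outside a finite list is at a positive distance [d] from it. Here [x] is not in [D],
   which contains [net_orbits_upto m], so approximations of [x] closer than [d] are [m]-fold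
   iterates. *)
have x_far (s : seq X) : x \notin s -> exists2 d : R, 0 < d &
    forall z, z \in s -> d <= rnorm (x - z).
  elim: s => [|z s IH]; first by exists 1.
  rewrite inE negb_or => /andP[xz /IH[d d0 ds]].
  have xz0 : 0 < rnorm (x - z).
    rewrite lt0r rnorm_ge0 andbT; apply: contra xz => /eqP/rnorm_eq0/eqP.
    by rewrite subr_eq0.
  exists (Num.min d (rnorm (x - z))); first by rewrite lt_min d0.
  move=> z'; rewrite inE => /predU1P[->|/ds dz']; first by rewrite ge_min lexx orbT.
  by rewrite ge_min dz'.
have [|d d0 d_far] := x_far (net_orbits_upto m).
  by apply/negP => /net_orbits_upto_sub/net_orbits_sub.
move=> e e0; move/closure_rnormP: Mx => /(_ (Num.min d e)).
case; first by rewrite lt_min d0.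
move=> y /(net_orbits_uptoP m)[/d_far dy|[y' Dy' ->]].
  by rewrite lt_min ltNge dy.
by rewrite lt_min => /andP[_ ye]; exists y'.
Qed.

Hypotheses (theta01 : 0 < theta < 1) (r_gt0 : 0 < r).

Lemma theta_pow_small (e : R) : 0 < e -> exists m, theta ^+ m * r < e.
Proof.
move=> e0; have /andP[t0 t1] := theta01.
have : (fun m => geometric r theta m) @ \oo --> (0 : R).
  by apply: cvg_geometric; rewrite gtr0_norm.
move=> /cvgrPdist_lt/(_ _ e0)[m _ /(_ m (leqnn m))].
rewrite sub0r normrN /geometric/= mulrC => /(le_lt_trans (ler_norm _)).
by exists m.
Qed.

(** An orbit point missing from the finite list is an [m]-fold iterate, hence within
    [theta ^+ m * r] of a center of level [m]. The strict inequality leaves room for passing to the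
    closure. *)
Lemma net_attractor_near m (eps : R) x : theta ^+ m * r < eps ->
  net_attractor x ->
  exists2 z, z \in net_orbits_upto m & rnorm (x - z) < eps.
Proof.
move=> m_eps /closure_rnormP Mx.
have [|y Qy xy] := Mx (eps - theta ^+ m * r); first by rewrite subr_gt0.
have r0 : 0 <= theta ^+ m * r.
  by case/andP: theta01 => t0 _; rewrite mulr_ge0 ?exprn_ge0 ?ltW.
have [z z_in yz] : exists2 z, z \in net_orbits_upto m & rnorm (y - z) <= theta ^+ m * r.
  have [y_in|[x' Dx' ->]] := net_orbits_uptoP m Qy; last exact: net_orbits_upto_cover.
  by exists y => //; rewrite subrr rnorm0.
exists z => //; apply: le_lt_trans (rnorm_triangle y _ _) _; lra.
Qed.

Lemma net_attractor_compact : compact net_attractor.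
Proof.
apply: totally_bounded_compact; first exact: closed_closure.
move=> e /theta_pow_small[m m_e]; exists (net_orbits_upto m) => x Mx.
by have [z z_in xz] := net_attractor_near m_e Mx; exists z; rewrite // rnormB.
Qed.

Variable h : R.
Hypothesis h_ge1 : 1 <= h.
Hypothesis E_size : forall m, (size (E m))%:R <= h ^+ m.

(** There are [m.+1] levels and [m.+1] iterates per level, each with at most [h ^+ m] points because
    [1 <= h]. *)
Lemma size_net_orbits_upto m :
  (size (net_orbits_upto m))%:R <= m.+1%:R ^+ 2 * h ^+ m.
Proof.
pose F i := [seq iter (j + i) f e | j <- iota 0 m.+1, e <- E i].
have size_F i : (i <= m)%N -> (size (F i))%:R <= m.+1%:R * h ^+ m.
  move=> im; rewrite size_allpairs size_iota natrM ler_wpM2l//.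
  by apply: le_trans (E_size i) _; rewrite ler_weXn2l.
have size_le s : (forall i, i \in s -> (i <= m)%N) ->
  (size (flatten (map F s)))%:R <= (size s)%:R * (m.+1%:R * h ^+ m).
  elim: s => [|i s IH] sm; first by rewrite mul0r.
  rewrite /= size_cat natrD -natr1 mulrDl mul1r [leRHS]addrC lerD//.
    by apply/size_F/sm; rewrite mem_head.
  by apply: IH => j js; apply: sm; rewrite inE js orbT.
apply: le_trans (size_le _ _) _.
  by move=> i; rewrite mem_iota; lia.
by rewrite size_iota expr2 mulrA.
Qed.

Lemma net_attractor_cover m (eps : R) : theta ^+ m * r < eps ->
  exists2 N : nat, N%:R <= m.+1%:R ^+ 2 * h ^+ m &
    is_ball_cover net_attractor eps N.
Proof.
move=> m_eps; exists (size (net_orbits_upto m)); first exact: size_net_orbits_upto.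
exists (fun i => nth 0 (net_orbits_upto m) i); split => [i|x Mx].
  by apply/subset_closure/(@net_orbits_upto_sub m)/mem_nth.
have [z z_in xz] := net_attractor_near m_eps Mx.
have zi : (index z (net_orbits_upto m) < size (net_orbits_upto m))%N by rewrite index_mem.
by exists (Ordinal zi) => //=; rewrite nth_index.
Qed.

Lemma net_attractor_dim :
  (fractal_dim net_attractor <= (ln h / ln (1 / theta))%:E)%E.
Proof. exact: fractal_dim_le h_ge1 theta01 r_gt0 net_attractor_cover. Qed.

End DiscreteAttractor.

(** * Omega-limit sets *)

Section TimeSet.
Context {R : realType} {Ts : set R}.
Hypothesis Ts_time : is_time_set Ts.

Lemma time_set0 : Ts 0.
Proof. by case: Ts_time => -> /=; [|exists 0%N]. Qed.

Lemma time_setD s t : Ts s -> Ts t -> Ts (s + t).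
Proof.
case: Ts_time => -> /=; first exact: addr_ge0.
by move=> [m _ <-] [n _ <-]; exists (m + n)%N; rewrite // natrD.
Qed.

Lemma time_setB s t : Ts s -> Ts t -> s <= t -> Ts (t - s).
Proof.
case: Ts_time => -> /=; first by rewrite subr_ge0.
move=> [m _ <-] [n _ <-]; rewrite ler_nat => mn.
by exists (n - m)%N; rewrite // natrB.
Qed.

Lemma time_setMn m t : Ts t -> Ts (m%:R * t).
Proof.
move=> Tt; elim: m => [|m IH]; first by rewrite mul0r; exact: time_set0.
by rewrite -natr1 mulrDl mul1r; exact: time_setD.
Qed.

Lemma time_set_ge0 t : Ts t -> 0 <= t.
Proof. by case: Ts_time => -> //= -[m _ <-]. Qed.

End TimeSet.

Lemma exists_nat_ge (R : archiRealFieldType) (x : R) : exists N : nat, x <= N%:R.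
Proof.
exists (Num.bound `|x|); apply: le_trans (ler_norm _) (ltW _).
exact: archi_boundP.
Qed.

Lemma exists_invS_lt (R : archiRealFieldType) (e : R) : 0 < e ->
  exists N : nat, forall i, (N <= i)%N -> i.+1%:R^-1 < e.
Proof.
move=> e0; have [N eN] := exists_nat_ge e^-1; exists N => i Ni.
rewrite invf_plt ?posrE//; apply: le_lt_trans eN _.
by rewrite ltr_nat ltnS.
Qed.

(** * Hausdorff semidistance and cluster points of sequences *)

Section Hsdist.
Context {R : realType} {k : scalar_kind} {X : normedModType (scalars R k)}.

Lemma hsdist_ge0 (G H : set X) : (0 <= hsdist G H)%E.
Proof. by rewrite /hsdist le_max lexx. Qed.

Lemma hsdist_le (G H : set X) (c : R) : 0 <= c ->
  (forall x, G x -> exists2 z, H z & rnorm (x - z) <= c) ->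
  (hsdist G H <= c%:E)%E.
Proof.
move=> c0 GH; rewrite /hsdist ge_max lee_fin c0 /=.
apply: ge_ereal_sup => _ [x Gx <-]; have [z Hz xz] := GH x Gx.
apply: (@le_trans _ _ (rnorm (x - z))%:E); last by rewrite lee_fin.
by apply: ereal_inf_lbound; exists z.
Qed.

Lemma cvg_within_pinfty0 (Ts : set R) (F : R -> \bar R) :
  (forall t, 0 <= F t)%E ->
  (forall e : R, 0 < e -> exists tau, forall t, Ts t -> tau <= t ->
    (F t <= e%:E)%E) ->
  F t @[t --> within Ts (pinfty_nbhs R)] --> 0%E.
Proof.
move=> F0 Fe U [e /= e0 eU]; have e20 : 0 < e / 2 by rewrite divr_gt0.
have [tau Ftau] := Fe _ e20.
exists tau; split; first exact: num_real.
move=> t tau_t Tt; have := F0 t; have := Ftau t Tt (ltW tau_t).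
case Ft : (F t) => [x||] //; rewrite !lee_fin => xe x0.
rewrite /preimage /= Ft; apply: eU; rewrite /ball_ /= sub0r normrN ger0_norm//; lra.
Qed.

Lemma cvg_seq_rnorm (v : nat -> X) (y : X) :
  (forall i, rnorm (v i - y) < i.+1%:R^-1) -> v @ \oo --> y.
Proof.
move=> vy U /nbhs_rnormP[e e0 eU]; have [N Ne] := exists_invS_lt e0.
exists N => // i /= Ni; apply: eU; rewrite rnormB.
exact: lt_trans (vy i) (Ne i Ni).
Qed.

(** The terms of [u] may lie outside [M], so compactness is applied to the points of [M] near late
    terms. [phi] need not be increasing: [i <= phi i] is enough for limits. *)
Lemma compact_rnorm_cluster (M : set X) (u : nat -> X) : compact M ->
  (forall e : R, 0 < e -> forall N : nat, exists j z,
     [/\ (N <= j)%N, M z & rnorm (u j - z) < e]) ->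
  exists2 y, M y &
    exists phi : nat -> nat, forall i, (i <= phi i)%N /\ rnorm (u (phi i) - y) < i.+1%:R^-1.
Proof.
move=> M_compact u_near.
pose near_u (N : nat) (e : R) : set X :=
  [set z | M z /\ exists2 j, (N <= j)%N & rnorm (u j - z) < e].
pose F : set_system X := [set U | exists N, exists2 e : R, 0 < e & near_u N e `<=` U].
have F_proper : ProperFilter F.
  split.
    move=> [N [e e0 sub0]]; have [j [z [Nj Mz jz]]] := u_near e e0 N.
    by apply: (sub0 z); split => //; exists j.
  split.
  - by exists 0%N, 1.
  - move=> U W [N [e e0 NU]] [N' [e' e0' NW]].
    exists (maxn N N'), (Num.min e e'); first by rewrite lt_min e0.
    move=> z [Mz [j]]; rewrite geq_max lt_min => /andP[Nj N'j] /andP[je je'].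
    by split; [apply: NU|apply: NW]; split => //; exists j.
  - move=> U W UW [N [e e0 NU]]; exists N, e => //.
    exact: subset_trans UW.
have FM : F M by exists 0%N, 1 => // z [].
have [y [My y_cluster]] := M_compact F F_proper FM.
exists y => //.
have /choice[phi phiP] i : exists j, (i <= j)%N /\ rnorm (u j - y) < i.+1%:R^-1.
  pose e : R := i.+1%:R^-1 / 2.
  have e0 : 0 < e by rewrite divr_gt0// invr_gt0.
  have [||z [[Mz [j ij jz]] yz]] := y_cluster (near_u i e) [set z | rnorm (y - z) < e].
  - by exists i, e.
  - by apply/nbhs_rnormP; exists e.
  exists j; split => //; apply: le_lt_trans (rnorm_triangle z _ _) _.
  by rewrite [ltRHS]splitr; apply: ltrD => //; rewrite rnormB.
by exists phi.
Qed.

End Hsdist.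

(** * The omega-limit set of the absorbing set, for a semigroup with a compact attracting set [M] *)

Section OmegaLimit.
Context {R : realType} {k : scalar_kind} {X : normedModType (scalars R k)}.
Variables (Ts : set R) (V B M : set X) (S : R -> X -> X).
Hypothesis Ts_time : is_time_set Ts.
Hypothesis V_closed : closed V.
Hypothesis S_semigroup : is_semigroup Ts V S.
Hypothesis B_bounded : bounded_set B.
Hypothesis B_absorbing : absorbing_set Ts V S B.
Hypothesis Ts_unbounded : forall N : nat, exists2 t, Ts t & N%:R <= t.

Definition omega_limit : set X :=
  [set x | forall (e : R) (N : nat), 0 < e ->
     exists t b, [/\ Ts t, N%:R <= t, B b & rnorm (S t b - x) < e]].

Let BV : B `<=` V. Proof. by case: B_absorbing. Qed.

Let SV t x : Ts t -> V x -> V (S t x).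
Proof. by case: S_semigroup => SV _ _ Tt Vx; apply: (SV t Tt); exists x. Qed.

Let SD t s x : Ts t -> Ts s -> V x -> S t (S s x) = S (t + s) x.
Proof. by case: S_semigroup => _ SD _; exact: SD. Qed.

Lemma omega_limit_sub_domain : omega_limit `<=` V.
Proof.
move=> x Ax; apply: V_closed; apply/closure_rnormP => e e0.
have [t [b [Tt _ Bb tb]]] := Ax e 0%N e0.
by exists (S t b); [apply: SV (BV Bb)|rewrite rnormB].
Qed.

Lemma omega_limit_closed : closed omega_limit.
Proof.
move=> x /closure_rnormP Ax e N e0.
have [|y Ay xy] := Ax (e / 2); first by rewrite divr_gt0.
have [|t [b [Tt Nt Bb tb]]] := Ay (e / 2) N; first by rewrite divr_gt0.
exists t, b; split => //; apply: le_lt_trans (rnorm_triangle y _ _) _.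
by rewrite [rnorm (y - x)]rnormB; lra.
Qed.

Lemma omega_limit_bounded : bounded_set omega_limit.
Proof.
have /bounded_set_rnormP[C BC] := B_bounded.
have [tB TtB tBB] := B_absorbing.2 B BV B_bounded.
have [N tN] := exists_nat_ge tB.
apply/bounded_set_rnormP; exists (C + 1) => x Ax.
have [t [b [Tt Nt Bb tb]]] := Ax 1 N ltr01.
have /BC SC : B (S t b) by apply: (tBB t) ; [exact: Tt|exact: le_trans Nt|exists b].
have := rnorm_triangle (S t b) x 0; rewrite !subr0 rnormB; lra.
Qed.

Lemma omega_limit_seqP x : omega_limit x -> exists t_ : nat -> R, exists x_ : nat -> X,
  forall j, [/\ Ts (t_ j), j%:R <= t_ j, B (x_ j) & rnorm (S (t_ j) (x_ j) - x) < j.+1%:R^-1].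
Proof.
move=> Ax.
have /choice[p pP] j : exists p : R * X, [/\ Ts p.1, j%:R <= p.1, B p.2 &
    rnorm (S p.1 p.2 - x) < j.+1%:R^-1].
  by have [|t [b tb]] := Ax j.+1%:R^-1 j; [rewrite invr_gt0|exists (t, b)].
by exists (fst \o p), (snd \o p).
Qed.

(* A time shift turns orbits from a bounded set into orbits from [B]. *)
Lemma omega_limit_of_seq (G : set X) (t_ : nat -> R) (x_ : nat -> X) y :
  G `<=` V -> bounded_set G -> (forall j, G (x_ j)) ->
  (forall j, Ts (t_ j)) -> (forall j, j%:R <= t_ j) ->
  (forall j, rnorm (S (t_ j) (x_ j) - y) < j.+1%:R^-1) -> omega_limit y.
Proof.
move=> GV G_bounded Gx Tt t_ge Sy e N e0.
have [tG TtG tGB] := B_absorbing.2 G GV G_bounded.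
have [N1 tN1] := exists_nat_ge tG; have [N2 N2e] := exists_invS_lt e0.
pose j := (N + N1 + N2)%N.
have jt : N%:R + tG <= t_ j.
  apply: le_trans (t_ge j); rewrite /j !natrD.
  by have := ler0n R N2; lra.
have Tjt : Ts (t_ j - tG).
  by apply: time_setB => //; apply: le_trans jt; rewrite lerDr.
exists (t_ j - tG), (S tG (x_ j)); split => //.
- by rewrite lerBrDr.
- by apply: (tGB tG) => //; exists (x_ j).
- rewrite SD ?subrK//; last exact: GV.
  by apply: lt_trans (Sy j) (N2e j _); rewrite leq_addl.
Qed.

Hypothesis M_compact : compact M.
Hypothesis M_closed : closed M.
Hypothesis M_attracts : forall G, G `<=` V -> bounded_set G ->
  forall e : R, 0 < e -> exists tau, forall t x, Ts t -> tau <= t -> G x ->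
    exists2 z, M z & rnorm (S t x - z) < e.

Lemma omega_limit_sub_attracting : omega_limit `<=` M.
Proof.
move=> x Ax; apply: M_closed; apply/closure_rnormP => e e0.
have e20 : 0 < e / 2 by rewrite divr_gt0.
have [tau Mtau] := M_attracts BV B_bounded e20.
have [N tauN] := exists_nat_ge tau.
have [t [b [Tt Nt Bb tb]]] := Ax _ N e20.
have [z Mz bz] := Mtau t b Tt (le_trans tauN Nt) Bb.
exists z => //; apply: le_lt_trans (rnorm_triangle (S t b) _ _) _.
by rewrite [rnorm (x - _)]rnormB; lra.
Qed.

Lemma omega_limit_compact : compact omega_limit.
Proof. exact: subclosed_compact omega_limit_closed M_compact omega_limit_sub_attracting. Qed.

(** Late terms approach the compact set [M], so a subsequence converges; its limit is in the
    omega-limit set of [B] by [omega_limit_of_seq]. *)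
Lemma asymptotically_compact (G : set X) (t_ : nat -> R) (x_ : nat -> X) :
  G `<=` V -> bounded_set G -> (forall j, G (x_ j)) ->
  (forall j, Ts (t_ j)) -> (forall j, j%:R <= t_ j) ->
  exists2 y, omega_limit y & exists phi : nat -> nat, forall i,
    (i <= phi i)%N /\ rnorm (S (t_ (phi i)) (x_ (phi i)) - y) < i.+1%:R^-1.
Proof.
move=> GV G_bounded Gx Tt t_ge.
have [|y My [phi phiP]] := @compact_rnorm_cluster _ _ _ M (fun j => S (t_ j) (x_ j)) M_compact.
  move=> e e0 N; have [tau Mtau] := M_attracts GV G_bounded e0.
  have [N' tauN'] := exists_nat_ge tau.
  have [|z Mz jz] := Mtau (t_ (N + N')%N) (x_ (N + N')%N) (Tt _) _ (Gx _).
    by apply: le_trans tauN' (le_trans _ (t_ge _)); rewrite ler_nat leq_addl.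
  by exists (N + N')%N, z; rewrite leq_addr.
exists y; last by exists phi.
apply: (@omega_limit_of_seq G (t_ \o phi) (x_ \o phi)) => //= j.
- by apply: le_trans (t_ge _); rewrite ler_nat; case: (phiP j).
- by case: (phiP j).
Qed.

(** Otherwise there are arbitrarily late points more than [e] away from the omega-limit set, and a
    subsequence of them converges to a point of that set. *)
Lemma omega_limit_attracts (G : set X) : G `<=` V -> bounded_set G ->
  forall e : R, 0 < e -> exists tau, forall t x, Ts t -> tau <= t -> G x ->
    exists2 z, omega_limit z & rnorm (S t x - z) <= e.
Proof.
move=> GV G_bounded e e0; apply: contrapT => /forallNP no_tau.
have /choice[p pP] (j : nat) : exists p : R * X, [/\ Ts p.1, j%:R <= p.1, G p.2 &
    forall z, omega_limit z -> e < rnorm (S p.1 p.2 - z)].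
  apply: contrapT => /forallNP no_p; apply: (no_tau j%:R) => t x Tt jt Gx.
  apply: contrapT => /forall2NP no_z; apply: (no_p (t, x)); split => //= z Az.
  by case: (no_z z) => // /negP; rewrite -ltNge.
have [| | |y Ay [phi phiP]] := @asymptotically_compact G (fst \o p) (snd \o p) GV G_bounded.
- by move=> j; case: (pP j).
- by move=> j; case: (pP j).
- by move=> j; case: (pP j).
have [N Ne] := exists_invS_lt e0.
have [_ py] := phiP N; have [_ _ _ /(_ y Ay)] := pP (phi N).
by rewrite ltNge ltW// (lt_trans py)// Ne.
Qed.

Hypothesis S_closed : asymptotically_closed Ts V S.

Lemma cvg_pinfty_of_nat_le (t_ : nat -> R) :
  (forall j, j%:R <= t_ j) -> t_ @ \oo --> +oo.
Proof.
move=> t_ge; apply/cvgryPge => A; have [N AN] := exists_nat_ge A.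
exists N => // i /= Ni; apply: le_trans AN (le_trans _ (t_ge i)).
by rewrite ler_nat.
Qed.

Let bounded_range (x_ : nat -> X) : (forall j, B (x_ j)) -> bounded_set (range x_).
Proof.
move=> Bx; have /bounded_set_rnormP[C BC] := B_bounded.
by apply/bounded_set_rnormP; exists C => _ [j _ <-]; exact: BC.
Qed.

(** Let [x] be the limit of [S (t_ j) (x_ j)]. Subsequences of [S (t + t_ j) (x_ j)] and
    [S (t_ j - t) (x_ j)] converge in the omega-limit set; asymptotic closedness identifies the
    first limit with [S t x] and shows that [S t] maps the second to [x]. *)
Lemma omega_limit_invariant t : Ts t -> S t @` omega_limit = omega_limit.
Proof.
move=> Tt; apply/seteqP; split=> [_ [x Ax <-]|x Ax];
  have [t_ [x_ txP]] := omega_limit_seqP Ax.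
  have [| | |y Ay [phi phiP]] :=
    @asymptotically_compact B (fun j => t + t_ j) x_ BV B_bounded.
  - by move=> j; case: (txP j).
  - by move=> j; case: (txP j) => Ttj _ _ _; exact: time_setD.
  - move=> j; case: (txP j) => _ jt _ _; apply: le_trans jt _.
    by rewrite lerDr; exact: time_set_ge0 Tt.
  rewrite (S_closed (t_ := t_ \o phi) (x_ := x_ \o phi) (y := y))//.
  - by move=> j; case: (txP (phi j)).
  - apply: cvg_pinfty_of_nat_le => j; case: (txP (phi j)) => _ jt _ _.
    by apply: le_trans jt; rewrite ler_nat; case: (phiP j).
  - by move=> j; apply: BV; case: (txP (phi j)).
  - by apply: bounded_range => j; case: (txP (phi j)).
  - exact: omega_limit_sub_domain.
  - exact: omega_limit_sub_domain.
  - apply: cvg_seq_rnorm => j; case: (txP (phi j)) => _ _ _ /lt_le_trans; apply.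
    by rewrite lef_pV2 ?posrE// ler_nat ltnS; case: (phiP j).
  - by apply: cvg_seq_rnorm => j; case: (phiP j).
(* Shifting the index by [N] keeps the times [t_ (j + N) - t] nonnegative and at least [j]. *)
have [N tN] := exists_nat_ge t.
have t_ge j : j%:R <= t_ (j + N)%N - t.
  by case: (txP (j + N)%N) => _ + _ _; rewrite natrD; lra.
have Tt_ j : Ts (t_ (j + N)%N - t).
  case: (txP (j + N)%N) => Ttj _ _ _; apply: time_setB => //.
  by rewrite -subr_ge0; apply: le_trans (t_ge j).
have Bx_ j : B (x_ (j + N)%N) by case: (txP (j + N)%N).
have [y Ay [phi phiP]] := asymptotically_compact BV B_bounded Bx_ Tt_ t_ge.
exists y => //.
apply: (S_closed (t_ := fun j => t_ (phi j + N)%N - t) (x_ := fun j => x_ (phi j + N)%N)) => //.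
- apply: cvg_pinfty_of_nat_le => j; apply: le_trans (t_ge (phi j)).
  by rewrite ler_nat; case: (phiP j).
- by move=> j; exact: BV.
- exact: bounded_range.
- exact: omega_limit_sub_domain.
- exact: omega_limit_sub_domain.
- by apply: cvg_seq_rnorm => j; case: (phiP j).
- apply: cvg_seq_rnorm => j; rewrite /= [t + _]addrC subrK.
  case: (txP (phi j + N)%N) => _ _ _ /lt_le_trans; apply.
  rewrite lef_pV2 ?posrE// ler_nat ltnS; apply: leq_trans (leq_addr _ _).
  by case: (phiP j).
Qed.

(** A bounded invariant set equals its image at a time when it has been absorbed. *)
Lemma omega_limit_sub_absorbing : omega_limit `<=` B.
Proof.
have [tA TtA tAB] :=
  B_absorbing.2 omega_limit omega_limit_sub_domain omega_limit_bounded.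
by rewrite -(omega_limit_invariant TtA); exact: tAB.
Qed.

Lemma omega_limit_global_attractor : B !=set0 -> global_attractor Ts V S omega_limit.
Proof.
move=> [b Bb]; split.
- exact: omega_limit_sub_domain.
(* For nonemptiness, take a cluster point of the orbit of [b] at times tending to infinity. *)
- have /choice[t_ t_P] (j : nat) : exists t, Ts t /\ j%:R <= t.
    by have [t] := Ts_unbounded j; exists t.
  have [| | |y Ay _] := @asymptotically_compact B t_ (fun=> b) BV B_bounded.
  + by [].
  + by move=> j; case: (t_P j).
  + by move=> j; case: (t_P j).
  by exists y.
- exact: omega_limit_compact.
- exact: omega_limit_invariant.
- move=> G GV G_bounded; apply: cvg_within_pinfty0 => [t|e e0].
    exact: hsdist_ge0.
  have [tau Atau] := omega_limit_attracts GV G_bounded e0.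
  exists tau => t Tt taut; apply: hsdist_le; first exact: ltW.
  by move=> _ [x Gx <-]; exact: Atau.
Qed.

End OmegaLimit.

(** * Reduction to discrete time *)

(** Half of the rate [2 * xi] compensates the weight; the remaining [expR (- (xi * t))] is small by
    [1 + xi * t <= expR (xi * t)]. *)
Lemma expR_linear_decay (R : realType) (C xi e : R) : 0 <= C -> 0 < xi -> 0 < e ->
  exists tau, forall t, tau <= t -> expR (xi * t) * (C * expR (- (2 * xi) * t)) <= e.
Proof.
move=> C0 xi0 e0; exists (C / (xi * e)) => t taut.
have t0 : 0 <= t by apply: le_trans taut; rewrite divr_ge0// mulr_ge0// ltW.
have -> : expR (xi * t) * (C * expR (- (2 * xi) * t)) = C * expR (- (xi * t)).
  by rewrite mulrCA -expRD; congr (_ * expR _); ring.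
rewrite expRN ler_pdivrMr ?expR_gt0//.
apply: (@le_trans _ _ (e * (1 + xi * t))); last by rewrite ler_pM2l ?expR_ge1Dx.
have : C <= t * (xi * e) by rewrite -ler_pdivrMr// mulr_gt0.
lra.
Qed.

Section Discretization.
Context {R : realType} {k : scalar_kind} {X : normedModType (scalars R k)}.
Variables (Ts : set R) (V B : set X) (S : R -> X -> X) (T : R).
Hypothesis Ts_time : is_time_set Ts.
Hypothesis S_semigroup : is_semigroup Ts V S.
Hypothesis B_bounded : bounded_set B.
Hypothesis B_absorbing : absorbing_set Ts V S B.
Hypotheses (TsT : Ts T) (T_gt0 : 0 < T).

Let BV : B `<=` V. Proof. by case: B_absorbing. Qed.

Let SV t x : Ts t -> V x -> V (S t x).
Proof. by case: S_semigroup => SV _ _ Tt Vx; apply: (SV t Tt); exists x. Qed.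

Let SD t s x : Ts t -> Ts s -> V x -> S t (S s x) = S (t + s) x.
Proof. by case: S_semigroup => _ SD _; exact: SD. Qed.

Lemma iter_semigroup m x : V x -> iter m (S T) x = S (m%:R * T) x.
Proof.
move=> Vx; elim: m => [|m IH]; first by case: S_semigroup => _ _ S0; rewrite mul0r S0.
rewrite /= IH SD//; last exact: time_setMn.
by rewrite -natr1 mulrDl mul1r addrC.
Qed.

Lemma exists_nat_mul_ge (x : R) : exists N : nat, x <= N%:R * T.
Proof. by have [N xN] := exists_nat_ge (x / T); exists N; rewrite -ler_pdivrMr. Qed.

(* [B] itself need not be mapped into itself by [S T]. *)
Lemma exists_invariant_absorbing : exists D : set X,
  [/\ D `<=` B, forall x, D x -> D (S T x)
    & forall G, G `<=` V -> bounded_set G -> exists2 tG, Ts tG &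
        forall t x, Ts t -> tG <= t -> G x -> D (S t x)].
Proof.
have [tB TtB tBB] := B_absorbing.2 B BV B_bounded.
have [N tN] := exists_nat_mul_ge tB.
(* The union of the images of [B] at times [j * T], [N <= j]: increasing [j] gives invariance, and
   [N * T] exceeds the time after which [B] stays in [B]. *)
exists [set y | exists2 j, (N <= j)%N & exists2 b, B b & y = S (j%:R * T) b].
split.
- move=> _ [j Nj [b Bb ->]]; apply: (tBB (j%:R * T)); last by exists b.
    exact: time_setMn.
  by apply: le_trans tN _; rewrite ler_pM2r// ler_nat.
- move=> _ [j Nj [b Bb ->]]; exists j.+1; first exact: leqW.
  by exists b; rewrite // -!iter_semigroup//; exact: BV.
- move=> G GV G_bounded; have [tG TtG tGB] := B_absorbing.2 G GV G_bounded.
  have TtN : Ts (N%:R * T) by exact: time_setMn.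
  exists (tG + N%:R * T); first exact: time_setD.
  move=> t x Tt tGt Gx.
  have Ntt : N%:R * T <= t by have := time_set_ge0 Ts_time TtG; lra.
  have Tu : Ts (t - N%:R * T) by exact: time_setB.
  exists N => //; exists (S (t - N%:R * T) x).
    by apply: (tGB _ Tu); [lra|exists x].
  by rewrite SD// ?(addrC (N%:R * T)) ?subrK//; exact: GV.
Qed.

Variables (D M : set X) (theta r : R).
Hypotheses (theta01 : 0 < theta < 1) (r_gt0 : 0 < r).
Hypothesis DV : D `<=` V.
Hypothesis D_absorbing : forall G, G `<=` V -> bounded_set G -> exists2 tG, Ts tG &
  forall t x, Ts t -> tG <= t -> G x -> D (S t x).
Hypothesis M_attracts_iter : forall m x, D x ->
  exists2 z, M z & rnorm (iter m (S T) x - z) <= theta ^+ m * r.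

(** [S t x] is reached in two stages: a time [t - m * T], at least [tG], leads into [D], and [m]
    iterations of [S T] then contract by [theta ^+ m], where [m] is the integer part of
    [(t - tG) / T]. *)
Lemma exponential_attraction : exists2 xi : R, 0 < xi &
  forall G, G `<=` V -> bounded_set G -> exists2 C : R, 0 <= C &
    exists tau, forall t x, Ts t -> tau <= t -> G x ->
      exists2 z, M z & rnorm (S t x - z) <= C * expR (- (2 * xi) * t).
Proof.
have /andP[theta0 theta1] := theta01.
pose a := - ln theta.
have a0 : 0 < a by rewrite oppr_gt0 ln_lt0.
exists (a / (2 * T)); first by rewrite divr_gt0// mulr_gt0.
move=> G GV G_bounded; have [tG TtG tGD] := D_absorbing GV G_bounded.
(* The summand [a] pays for rounding [q] down to [m], and [a * tG / T] for the waiting time. *)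
exists (r * expR (a + a * tG / T)); first by rewrite mulr_ge0 ?expR_ge0// ltW.
exists tG => t x Tt tGt Gx.
pose q := (t - tG) / T.
have q0 : 0 <= q by rewrite divr_ge0 ?subr_ge0// ltW.
have [m mq qm] : exists2 m : nat, m%:R <= q & q <= m%:R + 1.
  exists (Num.truncn q); first by rewrite truncn_le.
  by rewrite natr1 ltW// truncnS_gt.
have mT : m%:R * T <= t - tG by rewrite -ler_pdivlMr.
have TmT : Ts (m%:R * T) by exact: time_setMn.
have tG0 := time_set_ge0 Ts_time TtG.
have Ts_s : Ts (t - m%:R * T) by apply: time_setB => //; lra.
have Ds : D (S (t - m%:R * T) x) by apply: tGD => //; lra.
have [z Mz zle] := M_attracts_iter m Ds; exists z => //.
have -> : S t x = iter m (S T) (S (t - m%:R * T) x).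
  rewrite iter_semigroup; last exact: DV.
  by rewrite SD// ?(addrC (m%:R * T)) ?subrK//; exact: GV.
apply: le_trans zle _; rewrite mulrC -mulrA ler_pM2l//.
have -> : theta ^+ m = expR (- a * m%:R).
  have -> : - a * m%:R = ln (theta ^+ m) by rewrite /a opprK mulr_natr lnXn.
  by rewrite lnK// posrE exprn_gt0.
rewrite -expRD ler_expR.
have : a * q <= a * (m%:R + 1) by rewrite ler_pM2l.
have -> : a * q = a * t / T - a * tG / T by rewrite /q; field; rewrite gt_eqF.
have -> : - (2 * (a / (2 * T))) * t = - (a * t / T) by field; rewrite gt_eqF.
lra.
Qed.

End Discretization.

(** * Construction of the exponential attractor and of the global attractor inside it *)

Theorem theorem7p6 (R : realType) (k : scalar_kind)
    (X : completeNormedModType (scalars R k))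
    (ip : {dot X for @scalar_conj R k})
    (Ts : set R) (V : set X) (S : R -> X -> X) (B : set X)
    (T : R) (n : nat) (eta kappa : R) (P : X -> X) (Xn : set X) :
  norm_of_inner_product ip ->
  is_time_set Ts ->
  V !=set0 -> closed V ->
  is_semigroup Ts V S ->
  bounded_set B -> absorbing_set Ts V S B ->
  asymptotically_closed Ts V S \/ closed B ->
  is_orthogonal_projection ip P Xn ->
  ladyzhenskaya_type Ts S B T n eta kappa P Xn ->
  forall sigma : R, 0 < sigma < Num.sqrt (1 - eta ^+ 2) ->
  exists M0 : set X,
    [/\ M0 `<=` B,
        discrete_exponential_attractor Ts V S T M0,
        (fractal_dim M0 <=
          ((real_dim k n)%:R *
           log_base (1 / Num.sqrt (sigma ^+ 2 + eta ^+ 2))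
                    (1 + 2 * kappa / sigma))%:E)%E
      & asymptotically_closed Ts V S ->
        exists A : set X, global_attractor Ts V S A /\ A `<=` M0].
Proof.
move=> ip_norm Ts_time V0 V_closed S_sg B_bd B_abs ac_or P_proj lady sigma /andP[s0 s1].
have [[TsT T0] [n0 Xn_dim] [/andP[eta0 eta1] kappa0] _ f_lady] := lady.
pose theta := Num.sqrt (sigma ^+ 2 + eta ^+ 2).
pose h := (1 + 2 * kappa / sigma) ^+ real_dim k n.
have BV : B `<=` V by case: B_abs.
(* The upper bound on [sigma] says exactly that [sigma ^+ 2 + eta ^+ 2 < 1]. *)
have theta01 : 0 < theta < 1.
  rewrite sqrtr_gt0 ltr_pwDl ?exprn_gt0 ?sqr_ge0//=.
  rewrite -sqrtr1 ltr_sqrt// -ltrBrDr -[ltRHS]sqr_sqrtr.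
    by rewrite ltr_pXn2r// nnegrE ?sqrtr_ge0// ltW.
  by rewrite subr_ge0 expr_le1// ltW.
have ks0 : 0 < 2 * kappa / sigma by rewrite divr_gt0// mulr_gt0.
have h_ge1 : 1 <= h by rewrite exprn_ege1// lerDl ltW.
have [D [DB fD D_abs]] := exists_invariant_absorbing Ts_time S_sg B_bd B_abs TsT T0.
have D0 : D !=set0.
  have [v Vv] := V0; have [| |tv Ttv tvD] := D_abs [set v].
  - by move=> _ ->.
  - by apply/bounded_set_rnormP; exists (rnorm v) => _ ->.
  - by exists (S tv v); exact: tvD.
have [C BC] := (bounded_set_rnormP B).1 B_bd.
(* Bounds the diameter of [D]; the summand 1 makes it positive. *)
pose r := 2 * `|C| + 1.
have r0 : 0 < r by rewrite ltr_wpDl// mulr_ge0.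
have Dr x y : D x -> D y -> rnorm (x - y) <= r.
  move=> /DB/BC xC /DB/BC yC; have := ler_norm C; have := rnormD x (- y).
  by rewrite rnormN /r; lra.
have f_ladyD x y : D x -> D y ->
    rnorm ((S T x - P (S T x)) - (S T y - P (S T y))) <= eta * rnorm (x - y) /\
    rnorm (P (S T x) - P (S T y)) <= kappa * rnorm (x - y).
  by move=> /DB Bx /DB; exact: f_lady.
have /choice[E EP] m := iter_cover ip_norm Xn_dim P_proj eta0 kappa0 s0 f_ladyD fD m r0 Dr.
have ED m e : e \in E m -> D e by case: (EP m) => + _ _; exact.
have E_size m : (size (E m))%:R <= h ^+ m by case: (EP m).
have E_cover m x : D x -> exists2 e, e \in E m &
    rnorm (iter m (S T) x - iter m (S T) e) <= theta ^+ m * r.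
  by case: (EP m) => _ _; exact.
pose M := net_attractor (S T) E.
have M_compact : compact M by exact: net_attractor_compact fD ED E_cover theta01 r0.
have M_closed : closed M by exact: closed_closure.
have [xi xi0 M_exp] : exists2 xi : R, 0 < xi &
    forall G, G `<=` V -> bounded_set G -> exists2 C : R, 0 <= C &
    exists tau, forall t x, Ts t -> tau <= t -> G x ->
      exists2 z, M z & rnorm (S t x - z) <= C * expR (- (2 * xi) * t).
  apply: (exponential_attraction Ts_time S_sg TsT T0 theta01 r0 _ D_abs).
    by move=> x /DB/BV.
  by move=> m x Dx; exact: net_attractor_attracts E_cover _ _ Dx.
have M_attracts G : G `<=` V -> bounded_set G -> forall e : R, 0 < e ->
    exists tau, forall t x, Ts t -> tau <= t -> G x ->
    exists2 z, M z & rnorm (S t x - z) < e.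
  move=> GV G_bd e e0; have [c c0 [tau Gtau]] := M_exp G GV G_bd.
  have e20 : 0 < e / 2 by rewrite divr_gt0.
  have [tau' tau'P] := expR_linear_decay c0 xi0 e20.
  exists (Num.max tau (Num.max tau' 0)) => t x Tt.
  rewrite !ge_max => /and3P[taut tau't t0] Gx.
  have [z Mz zle] := Gtau t x Tt taut Gx; exists z => //.
  apply: le_lt_trans zle _; apply: (@le_lt_trans _ _ (e / 2)); last by lra.
  apply: le_trans (tau'P t tau't); rewrite ler_peMl ?mulr_ge0 ?expR_ge0//.
  by rewrite -expR0 ler_expR mulr_ge0// ltW.
have Ts_unbounded (N : nat) : exists2 t, Ts t & N%:R <= t.
  have [m Nm] := exists_nat_mul_ge T0 N%:R.
  by exists (m%:R * T) => //; exact: time_setMn.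
have [b0 Db0] := D0.
have B0 : B !=set0 by exists b0; exact: DB.
pose A := omega_limit Ts B S.
have AM : A `<=` M by exact: omega_limit_sub_attracting M_attracts.
have A_attractor : asymptotically_closed Ts V S -> global_attractor Ts V S A.
  by move=> ac; exact: omega_limit_global_attractor M_attracts ac B0.
have MB : M `<=` B.
  case: ac_or => [ac|B_closed].
    have AB : A `<=` B by exact: omega_limit_sub_absorbing M_attracts ac.
    move=> x Mx; have [/DB//|x_lim] := net_attractor_split fD ED Mx.
    (* A point of [M] outside [D] is approximated by [m]-fold iterates of points of [D] for every
       [m], hence belongs to the omega-limit set. *)
    apply: AB => e N e0.
    have [m Nm] := exists_nat_mul_ge T0 N%:R.
    have [y Dy xy] := x_lim m e e0.
    exists (m%:R * T), y; split => //; first exact: time_setMn.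
      exact: DB.
    by rewrite -(iter_semigroup Ts_time S_sg TsT)// 1?rnormB//; exact/BV/DB.
  apply: subset_trans B_closed; apply: closure_subset => x Qx.
  by apply: DB; exact: net_orbits_sub Qx.
have M_dim : (fractal_dim M <= ((real_dim k n)%:R *
    log_base (1 / theta) (1 + 2 * kappa / sigma))%:E)%E.
  have -> : (real_dim k n)%:R * log_base (1 / theta) (1 + 2 * kappa / sigma) =
      ln h / ln (1 / theta).
    by rewrite /log_base /h lnXn ?addr_gt0// mulrA mulr_natl.
  exact: (net_attractor_dim fD ED E_cover theta01 r0 h_ge1 E_size).
exists M; split => //; last by move=> ac; exists A; split => //; exact: A_attractor.
split => //.
- split; first by move=> x /MB/BV.
  have [z Mz _] := net_attractor_attracts E_cover 0 Db0.
  by exists z.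
(* Adding the two Ladyzhenskaya estimates makes [S T] Lipschitz on [B] with constant [eta + kappa].
   As [M] is in [B], the invariance of the orbits passes to their closure. *)
- move=> _ [x Mx <-]; apply/closure_rnormP => e e0.
  have ek0 : 0 < eta + kappa by rewrite ltr_wpDl.
  have [|y Qy xy] := (closure_rnormP _ _).1 Mx (e / (eta + kappa)).
    by rewrite divr_gt0.
  exists (S T y); first exact: net_orbits_f.
  have By : B y by apply: DB; exact: net_orbits_sub Qy.
  have [Qxy Pxy] := f_lady x y (MB _ Mx) By.
  have -> : S T x - S T y =
      (S T x - P (S T x) - (S T y - P (S T y))) + (P (S T x) - P (S T y)).
    by rewrite opprB addrACA addrNK [P (S T y) - S T y]addrC addrK.
  apply: le_lt_trans (rnormD _ _) _.
  move: xy; rewrite ltr_pdivlMr//; lra.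
- by apply: le_lt_trans M_dim _; rewrite ltry.
- exists xi => // G GV G_bd; have [c c0 [tau Gtau]] := M_exp G GV G_bd.
  apply: cvg_within_pinfty0 => [t|e e0].
    by rewrite mule_ge0 ?hsdist_ge0// lee_fin expR_ge0.
  have [tau' tau'P] := expR_linear_decay c0 xi0 e0.
  exists (Num.max tau tau') => t Tt; rewrite ge_max => /andP[taut tau't].
  apply: (@le_trans _ _ ((expR (xi * t))%:E * (c * expR (- (2 * xi) * t))%:E)%E).
    rewrite lee_wpmul2l ?lee_fin ?expR_ge0//; apply: hsdist_le.
      by rewrite mulr_ge0// expR_ge0.
    by move=> _ [x Gx <-]; exact: Gtau.
  by rewrite -EFinM lee_fin; exact: tau'P.
Qed.
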